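(* Let $T$ be a bounded linear operator on a complex Banach space $X$. The following are equivalent: (i) $T$ is rotationally uniformly ergodic. (ii) $r(T) \le 1$ and every $\lambda \in \sigma(T)\cap\mathbb T$ is a simple pole of the resolvent of $T$. (iii) The set $\{T^n: n\ge 0\}$ is relatively compact in operator norm. If any of these conditions holds, then $T$ is power-bounded and $\sigma(T)\cap \mathbb T$ is finite.
   Context: $\mathbb T$ is the unit circle in $\mathbb C$; $\sigma(T)$ and $r(T)$ are the spectrum and the spectral radius of $T$. A bounded operator $S$ is uniformly ergodic if $\frac1n\sum_{k=1}^nS^k$ converges in operator norm. $T$ is rotationally uniformly ergodic if $\lambda T$ is uniformly ergodic for every $\lambda\in\mathbb T$. $T$ is power-bounded if $\sup_n\|T^n\|<\infty$. *)

(* Defs.v *)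
From HB Require Import structures.
From mathcomp Require Import all_boot all_order all_algebra.
From mathcomp Require Import complex.
From mathcomp Require Import boolp classical_sets functions cardinality reals.
From mathcomp Require Import topology normedtype sequences derive.

Set Implicit Arguments.
Unset Strict Implicit.
Unset Printing Implicit Defensive.

Import Order.TTheory GRing.Theory Num.Theory.
Import numFieldNormedType.Exports.

Local Open Scope classical_set_scope.
Local Open Scope ring_scope.
Local Open Scope complex_scope.

Section BoundedOp.
Context {R : realType} {X : normedModType R[i]}.

Definition bounded_linear (f : X -> X) : Prop :=
  linear f /\ exists M : R, forall x, `|f x| <= M%:C * `|x|.

Definition bounded_linear_pred : {pred X -> X} :=
  fun f => `[< bounded_linear f >].

Lemma bounded_linear_submod : submod_closed bounded_linear_pred.
Proof.
split=> [|a f g /asboolP[lf [M fM]] /asboolP[lg [N gN]]]; apply/asboolP; split.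
- by move=> b x y; rewrite /= scaler0 addr0.
- by exists 0 => x; rewrite normr0 mul0r.
- move=> b x y; rewrite !fctE lf lg !scalerDr !scalerA (mulrC a b).
  by rewrite addrACA.
- have [c ca] : exists c : R, c%:C = `|a|.
    by exists (complex.Re `|a|); rewrite RRe_real ?normr_real.
  exists (c * M + N) => x; apply: (le_trans (ler_normD _ _)).
  rewrite normrZ rmorphD rmorphM /= mulrDl ca lerD// -mulrA.
  exact: ler_wpM2l.
Qed.

End BoundedOp.

HB.instance Definition _ (R : realType) (X : normedModType R[i]) :=
  GRing.isSubmodClosed.Build _ _ (@bounded_linear_pred R X)
    (@bounded_linear_submod R X).

(* The algebra L(X) of bounded linear operators on X *)
Record bounded_op (R : realType) (X : normedModType R[i]) := BoundedOp {
  bop_fun :> X -> X ;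
  bop_subproof : bop_fun \in @bounded_linear_pred R X }.

Section BoundedOpTheory.
Context {R : realType} {X : normedModType R[i]}.
Local Notation L := (bounded_op X).

HB.instance Definition _ := [isSub of L for @bop_fun R X].
HB.instance Definition _ := [Choice of L by <:].
HB.instance Definition _ := [SubChoice_isSubLmodule of L by <:].

Lemma bopP (S T : L) : S =1 T -> S = T.
Proof. by move=> ST; apply/val_inj/funext. Qed.

Lemma bop_linear (T : L) : linear T.
Proof. by case: T => f /= /asboolP[]. Qed.

HB.instance Definition _ (T : L) :=
  GRing.isLinear.Build R[i] X X *:%R T (bop_linear T).

Lemma bop_bounded (T : L) : exists M : R, forall x, `|T x| <= M%:C * `|x|.
Proof. by case: T => f /= /asboolP[]. Qed.

Lemma bop_id_subproof : (id : X -> X) \in @bounded_linear_pred R X.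
Proof. by apply/asboolP; split=> //; exists 1 => x; rewrite mul1r. Qed.

Lemma bop_comp_subproof (S T : L) : S \o T \in @bounded_linear_pred R X.
Proof.
apply/asboolP; split=> [a x y|]; first by rewrite /= !linearP.
have [M SM] := bop_bounded S; have [N TN] := bop_bounded T.
exists (Num.max M 0 * N) => x /=; apply: (le_trans (SM _)).
apply: (@le_trans _ _ ((Num.max M 0)%:C * `|T x|)).
  by rewrite ler_wpM2r// lecR le_max lexx.
by rewrite rmorphM/= -mulrA ler_wpM2l// lecR le_max lexx orbT.
Qed.

Definition bop_id : L := BoundedOp bop_id_subproof.
Definition bop_comp (S T : L) : L := BoundedOp (bop_comp_subproof S T).

Lemma bop_compA : associative bop_comp.
Proof. by move=> S T U; apply: bopP. Qed.
Lemma bop_comp1l : left_id bop_id bop_comp.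
Proof. by move=> S; apply: bopP. Qed.
Lemma bop_comp1r : right_id bop_id bop_comp.
Proof. by move=> S; apply: bopP. Qed.
Lemma bop_compDl : left_distributive bop_comp +%R.
Proof. by move=> S T U; apply: bopP. Qed.
Lemma bop_compDr : right_distributive bop_comp +%R.
Proof. by move=> S T U; apply: bopP => x; exact: linearD. Qed.

(* X may be the zero space, in which case 1 = 0 in L(X). *)
HB.instance Definition _ := GRing.Zmodule_isPzRing.Build L
  bop_compA bop_comp1l bop_comp1r bop_compDl bop_compDr.

(* The norm of X takes its values in R[i], where it is real. *)
Definition opnorm (T : L) : R :=
  sup [set complex.Re `|T x| | x in [set x : X | `|x| <= 1]].

Lemma opnorm_has_sup (T : L) :
  has_sup [set complex.Re `|T x| | x in [set x : X | `|x| <= 1]].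
Proof.
split; first by exists (complex.Re `|T 0|), 0; rewrite //= normr0 ler01.
have [M TM] := bop_bounded T; exists (Num.max M 0) => _ [x /= x1 <-].
rewrite -lecR RRe_real ?normr_real//; apply: (le_trans (TM x)).
apply: (@le_trans _ _ ((Num.max M 0)%:C * `|x|)).
  by rewrite ler_wpM2r// lecR le_max lexx.
by rewrite ler_piMr// lecR le_max lexx orbT.
Qed.

Lemma opnorm_ge0 (T : L) : 0 <= opnorm T.
Proof.
apply: sup_upper_bound; first exact: opnorm_has_sup.
by exists 0; rewrite /= ?normr0 ?ler01// linear0 normr0.
Qed.

Lemma opnorm_le1 (T : L) x : `|x| <= 1 -> `|T x| <= (opnorm T)%:C.
Proof.
move=> x1; rewrite -[`|T x|]RRe_real ?normr_real// lecR.
by apply: sup_upper_bound; [exact: opnorm_has_sup|exists x].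
Qed.

Lemma opnormP (T : L) x : `|T x| <= (opnorm T)%:C * `|x|.
Proof.
have [->|x0] := eqVneq x 0; first by rewrite linear0 !normr0 mulr0.
have nx : 0 < `|x| by rewrite normr_gt0.
rewrite -ler_pdivrMr// mulrC.
have <- : `|T (`|x|^-1 *: x)| = `|x|^-1 * `|T x|.
  by rewrite linearZ/= normrZ normfV normr_id.
by apply: opnorm_le1; rewrite normrZ normfV normr_id mulVf// gt_eqF.
Qed.

Lemma opnorm_le (T : L) (M : R) :
  (forall x, `|x| <= 1 -> `|T x| <= M%:C) -> opnorm T <= M.
Proof.
move=> TM; apply: ge_sup; first by case: (opnorm_has_sup T).
by move=> _ [x /= x1 <-]; rewrite -lecR RRe_real ?normr_real// TM.
Qed.

Lemma opnormD (S T : L) :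
  (opnorm (S + T))%:C <= (opnorm S)%:C + (opnorm T)%:C :> R[i].
Proof.
rewrite -rmorphD /= lecR; apply: opnorm_le => x x1; rewrite rmorphD /=.
by apply: (le_trans (ler_normD _ _)); rewrite lerD ?opnorm_le1.
Qed.

Lemma opnormZ_le (a : R[i]) (T : L) :
  (opnorm (a *: T))%:C <= `|a| * (opnorm T)%:C :> R[i].
Proof.
have [c ca] : exists c : R, c%:C = `|a|.
  by exists (complex.Re `|a|); rewrite RRe_real ?normr_real.
rewrite -ca -rmorphM/= lecR; apply: opnorm_le => x x1.
by rewrite normrZ rmorphM/= ca ler_wpM2l// opnorm_le1.
Qed.

Lemma opnormZ (a : R[i]) (T : L) :
  (opnorm (a *: T))%:C = `|a| * (opnorm T)%:C :> R[i].
Proof.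
apply/eqP; rewrite eq_le opnormZ_le/=.
have [->|a0] := eqVneq a 0.
  by rewrite normr0 mul0r lecR opnorm_ge0.
have := opnormZ_le a^-1 (a *: T); rewrite scalerA mulVf// scale1r normfV.
by rewrite mulrC ler_pdivlMr ?normr_gt0// mulrC.
Qed.

Lemma opnorm_eq0 (T : L) : (opnorm T)%:C = 0 :> R[i] -> T = 0.
Proof.
move=> T0; apply: bopP => x; apply/eqP.
by rewrite -normr_le0; apply: (le_trans (opnormP T x)); rewrite T0 mul0r.
Qed.

HB.instance Definition _ :=
  Lmodule_isNormed.Build R[i] L opnormD opnormZ opnorm_eq0.

End BoundedOpTheory.

(* R[i]^o is R[i] with its topology, seen as a normed space over itself. *)
Section Poles.
Context {R : realType} {V : normedModType R[i]}.
Implicit Types (f : R[i]^o -> V) (a : R[i]^o).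

Definition holomorphic_at f a : Prop := \forall z \near a, derivable f z 1.

Definition pole_of_order (m : nat) f a : Prop :=
  exists g : R[i]^o -> V,
    [/\ holomorphic_at g a, g a <> 0 &
        \forall z \near a^', f z = (z - a) ^- m *: g z].

End Poles.

Section Operators.
Context {R : realType} {X : normedModType R[i]}.
Local Notation L := (bounded_op X).
Implicit Types T S : L.

Definition is_inverse S T : Prop := S * T = 1 /\ T * S = 1.

Definition spectrum T : set R[i] :=
  [set z : R[i] | ~ exists S, is_inverse S (z *: (1 : L) - T)].

(* The value 0 on the spectrum is a default. *)
Definition resolvent T (z : R[i]^o) : L :=
  xget 0 [set S | is_inverse S (z *: (1 : L) - T)].

(* The spectrum is bounded, so sup is the supremum unless the spectrum is empty;
   sup set0 = 0, so the spectral radius is 0 when X is the zero space. *)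
Definition spectral_radius T : R := sup [set complex.Re `|z| | z in spectrum T].

Definition unit_circle : set R[i] := [set z | `|z| = 1].

Definition simple_pole_of_resolvent T (a : R[i]^o) : Prop :=
  (\forall z \near a^', ~ spectrum T z) /\ pole_of_order 1 (resolvent T) a.

Definition uniformly_ergodic S : Prop :=
  cvgn (fun n : nat => (n%:R^-1 : R[i]) *: (\sum_(1 <= k < n.+1) S ^+ k) : L).

Definition rotationally_uniformly_ergodic T : Prop :=
  forall a : R[i], unit_circle a -> uniformly_ergodic (a *: T).

Definition power_bounded T : Prop :=
  exists M : R, forall n : nat, opnorm (T ^+ n) <= M.

End Operators.

(* Main.v *)
Require Import Defs.
From HB Require Import structures.
From mathcomp Require Import all_boot all_order all_algebra.
From mathcomp Require Import complex.
From mathcomp Require Import boolp classical_sets functions cardinality reals.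
From mathcomp Require Import topology normedtype sequences derive.
From mathcomp Require Import ring lra.
Import Order.TTheory GRing.Theory Num.Theory.
Import numFieldNormedType.Exports.
Local Open Scope classical_set_scope.
Local Open Scope ring_scope.
Local Open Scope complex_scope.
Set Implicit Arguments.
Unset Strict Implicit.
Unset Printing Implicit Defensive.
Import Normc.

(** Everything is reduced to one algebraic property of [T]: for each [z] on the
unit circle, [A = z - T] has a group inverse, that is, some [B] commuting with
[A] satisfies [A * A * B = A] and [B * B * A = B].  Equivalently [X] is the
direct sum of the kernel and the range of [A], and [A] is invertible on its
range; [1 - A * B] is the projection onto the kernel along the range.

Condition (ii) says exactly this, together with the bound on the spectrum.  If
the resolvent is [g (w) / (w - z)] near [z] with [g] holomorphic, comparing
coefficients in [(w - T) g (w) = w - z] gives [A * g (z) = 0] and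
[A * g' (z) = 1 - g (z)], so [g' (z)] gives a group inverse
([simple_pole_group_inverse]).  Conversely a group inverse gives an explicit
formula for the resolvent around [z], with at most a simple pole
([group_inverse_simple_pole]).

(i) implies the property.  When the Cesaro means [C_n] of [S] converge to [P],
[1 - C_n = (1 - S) * B_n] with [B_n] a polynomial in [S], and
[(1 - S) * P = 0].  For large [n] the operator [1 - C_n + P] is invertible, and
[B_n] divided by it commutes with [A = 1 - S] and solves [A * A * B = A], which
is enough for a group inverse to exist
([ergodic_group_inverse]).  Convergence also makes [S ^+ n / n] tend to [0],
which bounds the spectrum ([ergodic_spectrum]).

The property implies (iii).  Points of the peripheral spectrum are isolated, so
there are finitely many of them.  With [Q = A * B] attached to such a point
[a], the operator [T * Q] has lost the spectral value [a] and keeps all the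
hypotheses, while [T ^+ n] and [(T * Q) ^+ n] differ by [a ^+ n *: (1 - Q)]
when [n > 0], which stays in a compact set.  After finitely many steps the
spectrum lies in the open disc, and then the powers tend to [0]
([disc_power_contraction]).  This last fact replaces the spectral radius
formula and is obtained without complex integration, from the identity
[(1 - x ^+ 2)^-1 = ((1 - x)^-1 + (1 + x)^-1) / 2] and the compactness of the
closed disc.

(iii) implies (i).  [C_N * S ^+ k - C_N] is small for large [N], uniformly for
[k] in a finite set; since finitely many powers approximate all of them, it is
small uniformly in [k].  Averaging over [k], [C_N * C_n] is close to [C_N] and,
by symmetry, to [C_n], so the means form a Cauchy sequence
([orbit_compact_ergodic]).  Rotations do not affect compactness of the orbit. *)

(** * The Banach algebra of bounded operators *)

Section BanachAlgebra.
Context {R : realType} {X : normedModType R[i]}.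
Local Notation L := (bounded_op X).
Implicit Types (S T U V A B : L) (a z : R[i]).

Lemma normr_normc a : `|a| = (normc a)%:C.
Proof. by case: a. Qed.

Lemma normr_opnorm T : `|T| = (opnorm T)%:C.
Proof. by []. Qed.

Lemma normc_ge0 a : 0 <= normc a.
Proof. rewrite -lecR -normr_normc; exact: normr_ge0. Qed.

Lemma normc_real (x : R) : normc x%:C = `|x|.
Proof. by rewrite /= expr0n/= addr0 sqrtr_sqr. Qed.

Lemma normcX a n : normc (a ^+ n) = normc a ^+ n.
Proof. by elim: n => [|n IH]; rewrite ?expr0 ?normc1 // !exprS normcM IH. Qed.

Lemma opnormDr S T : opnorm (S + T) <= opnorm S + opnorm T.
Proof. by rewrite -lecR rmorphD /= opnormD. Qed.

Lemma opnorm_scale a T : opnorm (a *: T) = normc a * opnorm T.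
Proof. by apply: (@complexI R); rewrite opnormZ rmorphM. Qed.

Lemma opnormN T : opnorm (- T) = opnorm T.
Proof. by rewrite -scaleN1r opnorm_scale normcN normc1 mul1r. Qed.

Lemma opnormB S T : opnorm (S - T) = opnorm (T - S).
Proof. by rewrite -opnormN opprB. Qed.

Lemma opnorm_sub S T : opnorm (S - T) <= opnorm S + opnorm T.
Proof. by rewrite -(opnormN T) opnormDr. Qed.

Lemma opnorm_triangle U S T : opnorm (S - T) <= opnorm (S - U) + opnorm (U - T).
Proof. by rewrite -[S - T](subrKA U) opnormDr. Qed.

Lemma opnorm0 : opnorm (0 : L) = 0.
Proof. by rewrite -(scale0r (0 : L)) opnorm_scale normc0 mul0r. Qed.

Lemma opnormM S T : opnorm (S * T) <= opnorm S * opnorm T.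
Proof.
apply: opnorm_le => x x1; rewrite rmorphM /=.
apply: (le_trans (opnormP S (T x))).
by rewrite ler_wpM2l// ?lecR ?opnorm_ge0// opnorm_le1.
Qed.

Lemma opnorm1 : opnorm (1 : L) <= 1.
Proof. exact: opnorm_le. Qed.

Lemma opnormX T n : opnorm (T ^+ n) <= opnorm T ^+ n.
Proof.
elim: n => [|n IH]; first by rewrite !expr0 opnorm1.
rewrite !exprS; apply: (le_trans (opnormM _ _)).
by rewrite ler_wpM2l// opnorm_ge0.
Qed.

Lemma opnorm_sum (I : Type) (r : seq I) (P : pred I) (F : I -> L) :
  opnorm (\sum_(i <- r | P i) F i) <= \sum_(i <- r | P i) opnorm (F i).
Proof.
elim/big_rec2 : _ => [|i x y _ IH]; first by rewrite opnorm0.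
by apply: (le_trans (opnormDr _ _)); rewrite lerD2l.
Qed.

Lemma bop_scaleAl a S T : a *: (S * T) = (a *: S) * T.
Proof. exact: bopP. Qed.

Lemma bop_scaleAr a S T : a *: (S * T) = S * (a *: T).
Proof. by apply: bopP => x /=; rewrite linearZ. Qed.

Lemma ltCR0 (e : R[i]) : 0 < e -> exists2 r : R, 0 < r & e = r%:C.
Proof.
move=> e0; exists (complex.Re e); last by rewrite RRe_real// gtr0_real.
by rewrite -ltcR RRe_real// gtr0_real.
Qed.

Lemma cvg_opnormP (T : Type) (F : set_system T) {FF : Filter F} (f : T -> L) (l : L) :
  f @ F --> l <-> forall e : R, 0 < e -> \forall x \near F, opnorm (l - f x) < e.
Proof.
split=> [/cvgrPdist_lt fl e e0|H].
  have := fl e%:C; rewrite ltcR => /(_ e0).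
  by apply: filterS => x; rewrite normr_opnorm ltcR.
apply/cvgrPdist_lt => e /ltCR0[r r0 ->].
by have := H r r0; apply: filterS => x; rewrite normr_opnorm ltcR.
Qed.

Lemma cvgn_opnormP (f : nat -> L) (l : L) :
  f @ \oo --> l <-> forall e : R, 0 < e ->
    exists n0, forall n, (n0 <= n)%N -> opnorm (l - f n) < e.
Proof.
split=> [/cvg_opnormP fl e /fl[n0 _ H]|H].
  by exists n0 => n; apply: H.
by apply/cvg_opnormP => e /H[n0 H0]; exists n0.
Qed.

End BanachAlgebra.

Section Complete.
Context {R : realType} {X : completeNormedModType R[i]}.
Local Notation L := (bounded_op X).

(** The limit is taken pointwise in the complete space [X]; the Cauchy estimate in
operator norm passes to the limit and controls the remainder. *)
Lemma bop_complete (u : nat -> L) :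
  (forall e : R, 0 < e -> exists n0, forall m n, (n0 <= m)%N -> (n0 <= n)%N ->
     opnorm (u m - u n) < e) ->
  exists l : L, u @ \oo --> l.
Proof.
move=> Hu.
have cx (x : X) : cvgn (fun n => u n x).
  apply/cauchy_cvgP/cauchy_ballP => e /ltCR0[r r0 ->].
  have [M M0 xM] : exists2 M : R, 0 < M & `|x| <= M%:C.
    exists (complex.Re `|x| + 1).
      by rewrite ltr_wpDl// -lecR RRe_real ?normr_real ?normr_ge0.
    by rewrite rmorphD/= RRe_real ?normr_real// lerDl.
  have [n0 Hn0] := Hu (r / M) (divr_gt0 r0 M0).
  near_simpl; exists ([set n | (n0 <= n)%N], [set n | (n0 <= n)%N]) => /=.
    by split; exists n0.
  move=> [m n] /= [mn0 nn0]; rewrite -ball_normE /=.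
  have -> : u m x - u n x = (u m - u n) x by [].
  apply: (le_lt_trans (opnormP _ _)).
  apply: (@le_lt_trans _ _ ((opnorm (u m - u n))%:C * M%:C)).
    by rewrite ler_wpM2l// lecR opnorm_ge0.
  by rewrite -rmorphM/= ltcR -ltr_pdivlMr// Hn0.
pose f x := limn (fun n => u n x).
have cf x : (fun n => u n x) @ \oo --> f x by exact: cx.
have lf : linear f.
  move=> a x y; apply: cvg_lim => //.
  under eq_fun do rewrite linearP.
  by apply: cvgD; [apply: cvgZl_tmp|]; exact: cf.
have near_f e n0 : (forall m n, (n0 <= m)%N -> (n0 <= n)%N ->
    opnorm (u m - u n) < e) -> forall n x, (n0 <= n)%N ->
    `|f x - u n x| <= e%:C * `|x|.
  move=> He n x nn0.
  apply/ler_addgt0Pr => d d0.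
  have /cvgrPdist_lt/(_ d d0)[n1 _ H1] := cf x.
  have := H1 (maxn n0 n1) (leq_maxr _ _); set m := maxn n0 n1 => /= Hm.
  rewrite -[f x - u n x](subrKA (u m x)) (le_trans (ler_normD _ _))// [leRHS]addrC.
  rewrite lerD ?(ltW Hm)//.
  have -> : u m x - u n x = (u m - u n) x by [].
  apply: (le_trans (opnormP _ _)); rewrite ler_wpM2r// lecR ltW// He//.
  exact: leq_maxl.
have fb : f \in @bounded_linear_pred R X.
  apply/asboolP; split=> //.
  have [n0 H0] := Hu 1 ltr01; exists (1 + opnorm (u n0)) => x.
  rewrite -(subrK (u n0 x) (f x)) rmorphD mulrDl.
  apply: (le_trans (ler_normD _ _)); rewrite lerD ?opnormP//.
  exact: near_f H0 _ _ _.
exists (BoundedOp fb); apply/cvgn_opnormP => e e0.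
have [n0 H0] := Hu (e / 2) (divr_gt0 e0 (ltr0Sn _ _)).
exists n0 => n nn0; apply: (@le_lt_trans _ _ (e / 2)); last first.
  by rewrite ltr_pdivrMr// ltr_pMr// ltr1n.
apply: opnorm_le => x x1; apply: (le_trans (near_f _ _ H0 n x nn0)).
by rewrite ler_piMr// lecR divr_ge0// ltW.
Qed.

End Complete.

(** * Inverses, resolvents and the Neumann series *)

Section Inverses.
Context {R : realType} {X : normedModType R[i]}.
Local Notation L := (bounded_op X).
Implicit Types (S T U V A B : L) (a z : R[i]).

Lemma cvg_opmull (I : Type) (F : set_system I) {FF : Filter F} (f : I -> L) A (l : L) :
  f @ F --> l -> (fun i => A * f i) @ F --> A * l.
Proof.
move=> /cvg_opnormP fl; apply/cvg_opnormP => e e0.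
have A1 : 0 < opnorm A + 1 by rewrite ltr_wpDl// opnorm_ge0.
apply: filterS (fl (e / (opnorm A + 1)) (divr_gt0 e0 A1)) => i fi.
rewrite -mulrBr; apply: (le_lt_trans (opnormM _ _)).
apply: (@le_lt_trans _ _ ((opnorm A + 1) * opnorm (l - f i))).
  by rewrite ler_wpM2r ?opnorm_ge0// lerDl.
by rewrite mulrC -ltr_pdivlMr.
Qed.

Lemma cvg_opmulr (I : Type) (F : set_system I) {FF : Filter F} (f : I -> L) A (l : L) :
  f @ F --> l -> (fun i => f i * A) @ F --> l * A.
Proof.
move=> /cvg_opnormP fl; apply/cvg_opnormP => e e0.
have A1 : 0 < opnorm A + 1 by rewrite ltr_wpDl// opnorm_ge0.
apply: filterS (fl (e / (opnorm A + 1)) (divr_gt0 e0 A1)) => i fi.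
rewrite -mulrBl; apply: (le_lt_trans (opnormM _ _)).
apply: (@le_lt_trans _ _ (opnorm (l - f i) * (opnorm A + 1))).
  by rewrite ler_wpM2l ?opnorm_ge0// lerDl.
by rewrite -ltr_pdivlMr.
Qed.

Lemma cvg_op_unique (I : Type) (F : set_system I) {FF : ProperFilter F}
    (f : I -> L) (l l' : L) :
  f @ F --> l -> f @ F --> l' -> l = l'.
Proof. by move=> fl fl'; apply: (cvg_unique _ fl fl'); exact: norm_hausdorff. Qed.

Lemma is_inverse_unique S S' T : is_inverse S T -> is_inverse S' T -> S = S'.
Proof. by move=> [ST _] [_ TS']; rewrite -[S]mulr1 -TS' mulrA ST mul1r. Qed.

Lemma is_inverse_comm S T U : is_inverse S T -> GRing.comm U T -> GRing.comm U S.
Proof.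
move=> [ST TS] UT.
by rewrite /GRing.comm -[U * S]mul1r -ST -!mulrA [T * (U * S)]mulrA -UT -mulrA TS mulr1.
Qed.

Lemma comm_scale a S T : GRing.comm S T -> GRing.comm S (a *: T).
Proof. by move=> ST; rewrite /GRing.comm -bop_scaleAr ST bop_scaleAl. Qed.

Lemma comm_shift a S T : GRing.comm S T -> GRing.comm S (a *: (1 : L) - T).
Proof.
by move=> ST; apply: commrB => //; apply: comm_scale; exact: commr1.
Qed.

Lemma is_inverse_scale a S T :
  a != 0 -> is_inverse S T -> is_inverse (a^-1 *: S) (a *: T).
Proof.
move=> a0 [ST TS]; split; rewrite -bop_scaleAl -bop_scaleAr scalerA.
  by rewrite mulVf// scale1r.
by rewrite mulfV// scale1r.
Qed.

Lemma resolventP T z :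
  ~ spectrum T z -> is_inverse (resolvent T z) (z *: (1 : L) - T).
Proof.
rewrite /spectrum /= => /contrapT[S TS].
exact: (@xgetPex _ 0 [set V | is_inverse V _] (ex_intro _ S TS)).
Qed.

Lemma not_spectrum T z V : is_inverse V (z *: (1 : L) - T) -> ~ spectrum T z.
Proof. by move=> VT sT; apply: sT; exists V. Qed.

Lemma resolvent_eq T z V : is_inverse V (z *: (1 : L) - T) -> resolvent T z = V.
Proof.
by move=> VT; exact: is_inverse_unique (resolventP (not_spectrum VT)) VT.
Qed.

End Inverses.

Lemma exprn_small (R : realType) (q e : R) : 0 <= q -> q < 1 -> 0 < e ->
  exists n0, forall n, (n0 <= n)%N -> q ^+ n < e.
Proof.
move=> q0 q1 e0; have /cvgrPdist_lt/(_ e e0)[n0 _ H] : q ^+ n @[n --> \oo] --> (0 : R).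
  by apply: cvg_expr; rewrite ger0_norm.
by exists n0 => n /H; rewrite /= sub0r normrN ger0_norm// exprn_ge0.
Qed.

Section Neumann.
Context {R : realType} {X : normedModType R[i]}.
Local Notation L := (bounded_op X).
Implicit Types (S T U V A B : L) (a z : R[i]).

Lemma geometric_sumE T n : (1 - T) * (\sum_(i < n) T ^+ i) = 1 - T ^+ n.
Proof.
rewrite -[X in _ = X]opprB subrX1 -mulNr; congr (_ * _).
by rewrite opprB.
Qed.

Lemma geometric_sum_comm T n : GRing.comm T (\sum_(i < n) T ^+ i).
Proof. by apply: commr_sum => i _; exact: commrX. Qed.

(** Left multiplication by [1 - S] is bounded below by [1 - q].  For the Neumann
series this does the work of summing a geometric series. *)
Lemma opnorm_1B S T q : opnorm S <= q -> q < 1 ->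
  opnorm T <= opnorm ((1 - S) * T) / (1 - q).
Proof.
move=> Sq q1; rewrite ler_pdivlMr ?subr_gt0// mulrBr mulr1 lerBlDr.
rewrite -[X in opnorm X <= _](subrK (S * T)) -{1}[T]mul1r -mulrBl.
apply: (le_trans (opnormDr _ _)); rewrite lerD2l.
apply: (le_trans (opnormM _ _)); rewrite mulrC ler_wpM2l// opnorm_ge0//.
Qed.

Lemma inverse_1B_bound S V q : opnorm S <= q -> q < 1 ->
  is_inverse V (1 - S) -> opnorm V <= (1 - q)^-1.
Proof.
move=> Sq q1 [_ SV]; apply: (le_trans (opnorm_1B V Sq q1)).
by rewrite SV ler_piMl ?opnorm1// invr_ge0 subr_ge0 ltW.
Qed.

(** [1 - T ^+ n] factors as [(1 - T)] times a commuting sum. *)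
Lemma inverse_of_power T n V : is_inverse V (1 - T ^+ n) ->
  exists W, is_inverse W (1 - T).
Proof.
move=> VT; set s := \sum_(i < n) T ^+ i; exists (V * s).
have cTV : GRing.comm T V.
  apply: is_inverse_comm VT _; apply: commrB; first exact: commr1.
  exact: commrX.
have c1V : GRing.comm (1 - T) V.
  by apply: commr_sym; apply: commrB; [exact: commr1|exact: commr_sym].
have c1s : GRing.comm (1 - T) s.
  apply: commr_sym; apply: commrB; first exact: commr1.
  by apply: commr_sym; exact: geometric_sum_comm.
split; last by rewrite mulrA c1V -mulrA geometric_sumE VT.1.
by rewrite -mulrA -c1s geometric_sumE VT.1.
Qed.

End Neumann.

Section NeumannSeries.
Context {R : realType} {X : completeNormedModType R[i]}.
Local Notation L := (bounded_op X).
Implicit Types (S T U V A B : L) (a z : R[i]).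

(** By [opnorm_1B] the partial sums [s n] are Cauchy as soon as the products
[(1 - T) * s n = 1 - T ^+ n] are. *)
Lemma neumann T : opnorm T < 1 -> exists V, is_inverse V (1 - T).
Proof.
move=> T1; pose s n := \sum_(i < n) T ^+ i.
have q0 : 0 < 1 - opnorm T by rewrite subr_gt0.
have XT e : 0 < e -> exists n0, forall n, (n0 <= n)%N -> opnorm (T ^+ n) < e.
  move=> e0; have [n0 H] := exprn_small (opnorm_ge0 T) T1 e0.
  by exists n0 => n /H; apply: le_lt_trans; exact: opnormX.
have [V sV] : exists V : L, s @ \oo --> V.
  apply: bop_complete => e e0.
  have [n0 H] := XT (e * (1 - opnorm T) / 2) (divr_gt0 (mulr_gt0 e0 q0) (ltr0Sn _ _)).
  exists n0 => m n mn0 nn0; apply: (le_lt_trans (opnorm_1B _ (lexx _) T1)).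
  rewrite ltr_pdivrMr// mulrBr !geometric_sumE.
  have -> : 1 - T ^+ m - (1 - T ^+ n) = T ^+ n - T ^+ m.
    by rewrite opprB addrC addrA subrK.
  apply: (le_lt_trans (opnorm_sub _ _)).
  by rewrite [ltRHS]splitr ltrD ?H.
have s1 : (fun n => (1 - T) * s n) @ \oo --> (1 : L).
  apply/cvgn_opnormP => e /XT[n0 H]; exists n0 => n /H.
  by rewrite geometric_sumE subKr.
have s2 : (fun n => s n * (1 - T)) @ \oo --> (1 : L).
  suff -> : (fun n => s n * (1 - T)) = (fun n => (1 - T) * s n) by [].
  apply/funext => n.
  apply: (@commrB _ (s n)); first exact: commr1.
  by apply: commr_sym; exact: geometric_sum_comm.
exists V; split.
  by apply: cvg_op_unique s2; exact: cvg_opmulr.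
by apply: cvg_op_unique s1; exact: cvg_opmull.
Qed.

Lemma not_spectrum_power T z n :
  z != 0 -> opnorm (T ^+ n) < normc z ^+ n -> ~ spectrum T z.
Proof.
move=> z0 Tz; have zn0 : 0 < normc z ^+ n := le_lt_trans (opnorm_ge0 _) Tz.
have powZ m : (z^-1 *: T) ^+ m = (z^-1) ^+ m *: T ^+ m.
  elim: m => [|m IH]; first by rewrite !expr0 scale1r.
  by rewrite !exprS IH -bop_scaleAl -bop_scaleAr scalerA.
have [V VT] : exists V, is_inverse V (1 - (z^-1 *: T) ^+ n).
  apply: neumann; rewrite powZ opnorm_scale normcX normcV exprVn.
  by rewrite mulrC ltr_pdivrMr// mul1r.
have [W WT] := inverse_of_power VT.
apply: (@not_spectrum _ _ _ _ (z^-1 *: W)).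
have := is_inverse_scale z0 WT; rewrite scalerBr scalerA mulfV// scale1r.
by [].
Qed.

Lemma spectrum_bounded T z : spectrum T z -> normc z <= opnorm T.
Proof.
move=> sz; rewrite leNgt; apply/negP => Tz.
apply: (@not_spectrum_power T z 1) => //.
apply/eqP => z0; move: Tz; rewrite z0 normc0 ltNge opnorm_ge0//.
Qed.

Lemma spectral_radius_le1P T :
  spectral_radius T <= 1 <-> forall z, spectrum T z -> normc z <= 1.
Proof.
split=> [T1 z sz|H].
  apply: le_trans T1; apply: sup_upper_bound; last by exists z; rewrite ?normr_normc.
  split; first by exists (normc z), z; rewrite ?normr_normc.
  by exists (opnorm T) => _ [w sw <-]; rewrite normr_normc; exact: spectrum_bounded.
rewrite /spectral_radius.
have [->|/set0P E] := eqVneq [set complex.Re `|z| | z in spectrum T] set0.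
  by rewrite sup0.
by apply: ge_sup => // _ [z sz <-]; rewrite normr_normc H.
Qed.

End NeumannSeries.

(** * Group inverses in a ring *)

Section GroupInverse.
Context {K : pzRingType}.
Implicit Types A B C : K.

(** The inverse of [A] in the monoid of elements of [K] whose unit is the idempotent
[A * B]. *)
Definition group_inverse B A :=
  [/\ A * B = B * A, A * A * B = A & B * B * A = B].

(** The equation [C * C * A = C] comes for free: with the idempotent [A * B], the element
[B * A * B] is the part of [B] that lies in the corner. *)
Lemma group_inverse_of_comm A B : A * B = B * A -> A * A * B = A ->
  exists C, group_inverse C A.
Proof.
move=> AB AAB; exists (B * A * B).
have E : A * B * (A * B) = A * B by rewrite mulrA -(mulrA A B A) -AB mulrA AAB.
have AC : A * (B * A * B) = A * B by rewrite -E !mulrA.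
have CA : B * A * B * A = A * B by rewrite -E AB !mulrA.
split; first by rewrite AC CA.
  by rewrite -mulrA AC mulrA AAB.
by rewrite -mulrA CA -(mulrA B A B) -mulrA E.
Qed.

(** The group inverse belongs to the bicommutant.  What commutes with [A] commutes
first with the idempotent [A * B] and then, inside its corner, with the inverse
of [A]. *)
Lemma group_inverse_comm A B C : group_inverse B A ->
  GRing.comm C A -> GRing.comm C B.
Proof.
case=> AB AAB BBA CA; rewrite /GRing.comm.
have EA : A * B * A = A by rewrite -mulrA -AB mulrA AAB.
have AE : A * (A * B) = A by rewrite mulrA.
have EB : A * B * B = B by rewrite AB -mulrA AB mulrA BBA.
have BE : B * (A * B) = B by rewrite AB mulrA BBA.
have CE : A * B * (C * (A * B)) = C * (A * B).
  by rewrite (mulrA C) CA !mulrA EA.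
have EC : A * B * (C * (A * B)) = A * B * C.
  by rewrite !mulrA AB -(mulrA B A C) -CA -!mulrA AE.
have cE : C * (A * B) = A * B * C by rewrite -CE EC.
have -> : B * C = A * B * C * B.
  by rewrite -[in LHS]BE -[LHS]mulrA -[in LHS]cE (mulrA C) CA !mulrA -AB.
by rewrite -cE -mulrA EB.
Qed.

End GroupInverse.

(** * Uniform ergodicity yields group inverses *)

Section Ergodic.
Context {R : realType} {X : completeNormedModType R[i]}.
Local Notation L := (bounded_op X).
Implicit Types (S T U V A B P : L) (a z : R[i]).

Lemma is_inverse_group_inverse V A : is_inverse V A -> group_inverse V A.
Proof. by move=> [VA AV]; split; rewrite ?AV ?VA // -mulrA ?AV ?VA mulr1. Qed.

Lemma group_inverse_scale a B A : a != 0 ->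
  group_inverse B A -> group_inverse (a^-1 *: B) (a *: A).
Proof.
move=> a0 [AB AAB BBA]; split; rewrite -!(bop_scaleAl, bop_scaleAr) !scalerA.
- by rewrite ?mulfV// ?mulVf// AB.
- by rewrite mulVf// mul1r AAB.
- by rewrite mulfV// mul1r BBA.
Qed.

Lemma normc_nat n : normc (n%:R : R[i]) = n%:R.
Proof. by rewrite -(rmorph_nat (real_complex R)) normc_real normr_nat. Qed.

Lemma normc_natV n : normc (n%:R^-1 : R[i]) = n%:R^-1.
Proof. by rewrite normcV normc_nat. Qed.

Definition cesaro_mean S n : L := (n%:R^-1 : R[i]) *: (\sum_(1 <= k < n.+1) S ^+ k).

Lemma cesaroK S n : (0 < n)%N ->
  n%:R *: cesaro_mean S n = \sum_(1 <= k < n.+1) S ^+ k.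
Proof. by move=> n0; rewrite scalerA mulfV ?scale1r// pnatr_eq0 -lt0n. Qed.

Lemma opnorm_nat n T : opnorm ((n%:R : R[i]) *: T) = n%:R * opnorm T.
Proof. by rewrite opnorm_scale normc_nat. Qed.

Lemma mul_1B_cesaro S n :
  (1 - S) * cesaro_mean S n = (n%:R^-1 : R[i]) *: (S - S ^+ n.+1).
Proof.
rewrite /cesaro_mean -bop_scaleAr; congr (_ *: _).
rewrite big_add1 /= big_mkord mulr_sumr.
under eq_bigr do rewrite mulrBl mul1r -exprS.
by rewrite -(big_mkord xpredT (fun i => S ^+ i.+1 - S ^+ i.+2)) -[RHS]opprB
  -[X in _ = - (_ - X)]expr1 -(@telescope_sumr _ 0 n (fun i => S ^+ i.+1))// -sumrN;
  apply: eq_bigr => i _; rewrite opprB.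
Qed.

Lemma sub1_cesaro S n : (0 < n)%N ->
  1 - cesaro_mean S n =
  (1 - S) * ((n%:R^-1 : R[i]) *: \sum_(1 <= k < n.+1) \sum_(i < k) S ^+ i).
Proof.
move=> n0; rewrite -bop_scaleAr mulr_sumr.
under eq_bigr do rewrite geometric_sumE.
rewrite sumrB sumr_const_nat subn1 /= scalerBr; congr (_ - _).
by rewrite -(@scaler_nat R[i] L) scalerA mulVf ?scale1r// pnatr_eq0 -lt0n.
Qed.

Lemma uniformly_ergodicP S : uniformly_ergodic S <->
  exists P, cesaro_mean S @ \oo --> P.
Proof. by split=> [/cvg_ex|/cvg_ex]. Qed.

(** With [C_n] the Cesaro means, [S ^+ n.+1 = n.+1 *: (C_n.+1 - C_n) + C_n]: the
first term is small compared with [n] and the second is bounded. *)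
Lemma ergodic_power_small S : uniformly_ergodic S ->
  forall e : R, 0 < e -> exists n0, forall n, (n0 <= n)%N ->
    opnorm (S ^+ n) <= e * n%:R.
Proof.
move=> /uniformly_ergodicP[P /cvgn_opnormP SP] e e0.
have e4 : 0 < e / 4 by rewrite divr_gt0.
have [n0 H] := SP _ e4.
have [n1 Hn1] : exists n1, opnorm P + e <= n1%:R * (e / 4).
  exists (Num.bound ((opnorm P + e) / (e / 4))).
  rewrite -ler_pdivrMr//; apply/ltW/archi_boundP.
  by rewrite divr_ge0// ?addr_ge0 ?opnorm_ge0// ltW.
exists (n0 + n1).+2 => -[//|n] /ltnSE nn.
have nn0 : (n0 <= n)%N by rewrite (leq_trans _ nn)// leqW// leq_addr.
have nn1 : (n1 <= n)%N by rewrite (leq_trans _ nn)// leqW// leq_addl.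
have n_gt0 : (0 < n)%N by rewrite (leq_trans _ nn).
have -> : S ^+ n.+1 =
    (n.+1)%:R *: (cesaro_mean S n.+1 - cesaro_mean S n) + cesaro_mean S n.
  rewrite scalerBr cesaroK// big_nat_recr//= -natr1 scalerDl scale1r cesaroK//.
  by rewrite opprD addrA subrK addrAC subrr add0r.
apply: (le_trans (opnormDr _ _)); rewrite opnorm_nat.
have d1 : opnorm (cesaro_mean S n.+1 - cesaro_mean S n) <= e / 4 + e / 4.
  apply: (le_trans (opnorm_triangle P _ _)); rewrite lerD// ltW// ?H//.
  by rewrite opnormB H// leqW.
have d2 : opnorm (cesaro_mean S n) <= opnorm P + e / 4.
  rewrite -[cesaro_mean S n](subrK P) addrC (le_trans (opnormDr _ _))// lerD2l.
  by rewrite opnormB ltW// H.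
have d3 : opnorm P + e <= n.+1%:R * (e / 4).
  by apply: (le_trans Hn1); rewrite ler_pM2r// ler_nat leqW.
have d4 : n.+1%:R * opnorm (cesaro_mean S n.+1 - cesaro_mean S n) <=
    n.+1%:R * (e / 4 + e / 4).
  by rewrite ler_wpM2l.
have P0 := opnorm_ge0 P.
nra.
Qed.

(** With [U = 1 - C_n + P] for a large [n], [(1 - S) * U = (1 - S) * (1 - S) * B0]
because [(1 - S) * P = 0]; so [B0] times the
inverse of [U] is as required by [group_inverse_of_comm]. *)
Lemma ergodic_group_inverse S : uniformly_ergodic S ->
  exists B, group_inverse B (1 - S).
Proof.
move=> eS; have [P SP] := (uniformly_ergodicP S).1 eS.
have cSc n : GRing.comm S (cesaro_mean S n).
  apply: comm_scale; apply: commr_sum => k _; exact: commrX.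
have SP1 : (fun n => (1 - S) * cesaro_mean S n) @ \oo --> (1 - S) * P.
  exact: (cvg_opmull (A := 1 - S) SP).
(* By telescoping, (1 - S) C_n = (S - S^(n+1)) / n, which tends to 0. *)
have SP0 : (1 - S) * P = 0.
  apply: (cvg_op_unique SP1).
  apply/cvgn_opnormP => e e0.
  have e4 : 0 < e / 4 by rewrite divr_gt0.
  have [n0 H] := ergodic_power_small eS e4.
  have [n1 Hn1] : exists n1, opnorm S <= n1%:R * (e / 4).
    exists (Num.bound (opnorm S / (e / 4))).
    rewrite -ler_pdivrMr//; apply/ltW/archi_boundP.
    by rewrite divr_ge0// ?opnorm_ge0// ltW.
  exists (n0 + n1).+1 => n nn.
  have nn0 : (n0 <= n)%N by rewrite (leq_trans _ nn)// leqW// leq_addr.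
  have nn1 : (n1 <= n)%N by rewrite (leq_trans _ nn)// leqW// leq_addl.
  have n_gt0 : (0 < n)%N by rewrite (leq_trans _ nn).
  rewrite sub0r opnormN mul_1B_cesaro opnorm_scale normc_natV.
  rewrite mulrC ltr_pdivrMr ?ltr0n//.
  apply: (le_lt_trans (opnorm_sub _ _)).
  have d1 := H n.+1 (leqW nn0).
  have d2 : opnorm S <= n%:R * (e / 4).
    by apply: (le_trans Hn1); rewrite ler_pM2r// ler_nat.
  have d3 : e <= e * n%:R by rewrite ler_peMr ?ler1n// ltW.
  by rewrite -[n.+1%:R]natr1 in d1; lra.
have PS0 : P * (1 - S) = 0.
  rewrite -SP0; apply: (cvg_op_unique _ SP1).
  suff -> : (fun n => (1 - S) * cesaro_mean S n) = (fun n => cesaro_mean S n * (1 - S)).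
    exact: (cvg_opmulr (A := 1 - S) SP).
  by apply/funext => n; apply: commr_sym; apply: commrB; [exact: commr1|exact/commr_sym].
have [n0 H] := (cvgn_opnormP (cesaro_mean S) P).1 SP 1 ltr01.
pose n := n0.+1.
pose B0 : L := (n%:R^-1 : R[i]) *: \sum_(1 <= k < n.+1) \sum_(i < k) S ^+ i.
have AB0 : (1 - S) * B0 = 1 - cesaro_mean S n by rewrite -sub1_cesaro.
have B0S : GRing.comm (1 - S) B0.
  apply: comm_scale; apply: commr_sum => k _; apply: commr_sum => i _.
  apply: commrX; apply: commr_sym; apply: commrB; first exact: commr1.
  exact: commr_refl.
have [V VU] : exists V, is_inverse V (1 - (cesaro_mean S n - P)).
  by apply: neumann; rewrite opnormB H.
have AU : (1 - S) * (1 - (cesaro_mean S n - P)) = (1 - S) * (1 - S) * B0.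
  by rewrite -mulrA AB0 opprB addrCA mulrDr SP0 add0r.
have cV : GRing.comm (1 - S) V.
  apply: is_inverse_comm VU _; apply: commrB; first exact: commr1.
  apply: commrB; last by rewrite /GRing.comm SP0 PS0.
  by apply: commr_sym; apply: commrB; [exact: commr1|exact/commr_sym].
apply: (@group_inverse_of_comm _ (1 - S) (B0 * V)).
  exact: commrM.
by rewrite mulrA -AU -mulrA VU.2 mulr1.
Qed.

Lemma rotation_group_inverse T a : a != 0 -> uniformly_ergodic (a^-1 *: T) ->
  exists B, group_inverse B (a *: (1 : L) - T).
Proof.
move=> a0 /ergodic_group_inverse[B HB]; exists (a^-1 *: B).
by have := group_inverse_scale a0 HB; rewrite scalerBr scalerA mulfV// scale1r.
Qed.

(** If [normc z = 1 + h] with [h > 0], Bernoulli's inequality makes [normc z ^+ n]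
exceed [n * h], hence exceed [opnorm (T ^+ n)] for a suitable [n]. *)
Lemma ergodic_spectrum T z : uniformly_ergodic T -> spectrum T z -> normc z <= 1.
Proof.
move=> eT sz; rewrite leNgt; apply/negP => z1.
pose h := normc z - 1; have h0 : 0 < h by rewrite subr_gt0.
have h2 : 0 < h / 2 by rewrite divr_gt0.
have [n H] := ergodic_power_small eT h2.
apply: (@not_spectrum_power _ _ T z n.+1) sz.
  by apply/eqP => z0; move: z1; rewrite z0 normc0 ltNge ler01.
apply: (le_lt_trans (H _ (leqnSn n))).
have -> : normc z = 1 + h by rewrite addrC subrK.
have bern m : 1 + m%:R * h <= (1 + h) ^+ m.
  elim: m => [|m IH]; first by rewrite expr0 mul0r addr0.
  rewrite exprS; apply: (@le_trans _ _ ((1 + h) * (1 + m%:R * h))).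
    have m0 : 0 <= m%:R * h * h by rewrite !mulr_ge0// ltW.
    by rewrite -[m.+1%:R]natr1; lra.
  by rewrite ler_pM2l// addr_gt0.
apply: lt_le_trans (bern _).
have : 0 <= n.+1%:R * h by rewrite mulr_ge0// ltW.
by lra.
Qed.

End Ergodic.

(** * Simple poles of the resolvent and group inverses *)

Section ComplexNeighborhoods.
Context {R : realType}.
Implicit Types (a z : R[i]^o) (Q : R[i]^o -> Prop).

Lemma near_normcP a Q : (\forall z \near a, Q z) <->
  exists2 e : R, 0 < e & forall z, normc (z - a) < e -> Q z.
Proof.
split=> [/nbhs_ballP[e /= /ltCR0[r r0 ->] H]|[e e0 H]].
  exists r => // z zr; apply: H.
  by rewrite -ball_normE /= distrC normr_normc ltcR.
apply/nbhs_ballP; exists e%:C; first by rewrite /= ltcR.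
by move=> z; rewrite -ball_normE /= distrC normr_normc ltcR; exact: H.
Qed.

Lemma dnear_normcP a Q : (\forall z \near a^', Q z) <->
  exists2 e : R, 0 < e & forall z, z != a -> normc (z - a) < e -> Q z.
Proof.
rewrite near_withinE; split=> [/near_normcP[e e0 H]|[e e0 H]].
  by exists e => // z za ze; exact: H.
by apply/near_normcP; exists e => // z ze za; exact: H.
Qed.

End ComplexNeighborhoods.

Section Poles.
Context {R : realType} {X : completeNormedModType R[i]}.
Local Notation L := (bounded_op X).
Implicit Types (S T U V A B P : L) (a z : R[i]).

Lemma cvg_op_near (I : Type) (F : set_system I) {FF : Filter F}
    (f g : I -> L) (l : L) :
  f @ F --> l -> (\forall i \near F, f i = g i) -> g @ F --> l.
Proof.
move=> fl fg; apply: cvg_trans fl.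
by apply: near_eq_cvg; apply: filterS fg.
Qed.

Lemma cvg_op_unique_near (I : Type) (F : set_system I) {FF : ProperFilter F}
    (f g : I -> L) (l l' : L) :
  f @ F --> l -> g @ F --> l' -> (\forall i \near F, f i = g i) -> l = l'.
Proof.
by move=> fl gl' fg; apply: (cvg_op_unique _ gl'); exact: cvg_op_near fg.
Qed.

(** With [G h = g (a + h)], [P = g a] and [D h = (G h - P) / h], the equation
[(h + A) * G h = h] gives [A * P = 0] in the limit; subtracting
[(h + A) * P = h *: P] and dividing by [h] gives [(h + A) * D h = 1 - P], whose
limit is [A * B = 1 - P] for [B] the derivative of [g].  The same holds with the
factors exchanged. *)
Lemma simple_pole_group_inverse T a : simple_pole_of_resolvent T a ->
  exists B, group_inverse B (a *: (1 : L) - T).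
Proof.
move=> [/dnear_normcP[e1 e10 H1] [g [hol _ /dnear_normcP[e2 e20 H2]]]].
pose A := a *: (1 : L) - T; pose P := g a; pose G (h : R[i]^o) := g (h + a).
pose D (h : R[i]^o) : L := h^-1 *: (G h - P).
pose F := (0 : R[i]^o)^'.
have [B DB] : exists B : L, D @ F --> B.
  have /cvg_ex[B HB] := nbhs_singleton hol; exists B.
  have -> : D = fun h => h^-1 *: ((g \o shift a) (h *: (1 : R[i]^o)) - g a);
    last exact: HB.
  by apply/funext => h; rewrite /= [h *: _]mulr1.
have inv h : h != 0 -> normc h < e1 -> normc h < e2 ->
    is_inverse (h^-1 *: G h) (h *: (1 : L) + A).
  move=> h0 he1 he2; have ha : h + a != a by rewrite -subr_eq0 addrK.
  have := resolventP (H1 (h + a) ha _); rewrite addrK => /(_ he1).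
  by rewrite H2 ?addrK// scalerDl addrA.
have nearF (Q : R[i]^o -> Prop) :
    (forall h, h != 0 -> is_inverse (h^-1 *: G h) (h *: (1 : L) + A) -> Q h) ->
    \forall h \near F, Q h.
  move=> HQ; apply/dnear_normcP; exists (Num.min e1 e2); first by rewrite lt_min e10.
  by move=> h h0; rewrite subr0 lt_min => /andP[? ?]; apply: HQ => //; exact: inv.
have idF : (fun h : R[i]^o => h) @ F --> (0 : R[i]^o) by exact: cvg_within.
have hD : (fun h => h *: D h) @ F --> (0 : L).
  by rewrite -(scale0r B); exact: cvgZ.
have GP : G @ F --> P.
  have PhD : (fun h : R[i]^o => (P + h *: D h : L)) @ F --> (P : L).
    by rewrite -[X in _ --> X]addr0; exact: (cvgD (cvg_cst _) hD).
  apply: (cvg_op_near PhD); apply: nearF => h h0 _.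
  by rewrite /= /D scalerA mulfV// scale1r addrC subrK.
have hG : (fun h : R[i]^o => h *: (1 - G h)) @ F --> (0 : L).
  by rewrite -(scale0r (1 - P)); apply: cvgZ => //; exact: cvgB (cvg_cst _) GP.
have AP : A * P = 0.
  apply: (cvg_op_unique_near (cvg_opmull (A := A) GP) hG).
  apply: nearF => h h0 [_]; rewrite -bop_scaleAr mulrDl -bop_scaleAl mul1r.
  move=> /(congr1 (fun x => h *: x)); rewrite scalerA mulfV// scale1r => E.
  by rewrite scalerBr -E addrC addKr.
have PA : P * A = 0.
  apply: (cvg_op_unique_near (cvg_opmulr (A := A) GP) hG).
  apply: nearF => h h0 [+ _]; rewrite -bop_scaleAl mulrDr -bop_scaleAr mulr1.
  move=> /(congr1 (fun x => h *: x)); rewrite scalerA mulfV// scale1r => E.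
  by rewrite scalerBr -E addrC addKr.
have AB : A * B = 1 - P.
  have l1 : (fun h : R[i]^o => (h *: D h + A * D h : L)) @ F --> (A * B : L).
    by rewrite -[X in _ --> X]add0r; exact: (cvgD hD (cvg_opmull (A := A) DB)).
  have l2 : (fun=> (1 - P : L)) @ F --> (1 - P : L) by exact: cvg_cst.
  apply: (cvg_op_unique_near l1 l2).
  apply: nearF => h h0 [_ E].
  have -> : h *: D h + A * D h = (h *: (1 : L) + A) * D h.
    by rewrite [RHS]mulrDl -bop_scaleAl mul1r.
  rewrite /D scalerBr mulrBr E; congr (_ - _).
  by rewrite -bop_scaleAr mulrDl AP addr0 -bop_scaleAl mul1r scalerA mulVf// scale1r.
have BA : B * A = 1 - P.
  have l1 : (fun h : R[i]^o => (h *: D h + D h * A : L)) @ F --> (B * A : L).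
    by rewrite -[X in _ --> X]add0r; exact: (cvgD hD (cvg_opmulr (A := A) DB)).
  have l2 : (fun=> (1 - P : L)) @ F --> (1 - P : L) by exact: cvg_cst.
  apply: (cvg_op_unique_near l1 l2).
  apply: nearF => h h0 [E _].
  have -> : h *: D h + D h * A = D h * (h *: (1 : L) + A).
    by rewrite [RHS]mulrDr -bop_scaleAr mulr1.
  rewrite /D scalerBr mulrBl E; congr (_ - _).
  by rewrite -bop_scaleAl mulrDr PA addr0 -bop_scaleAr mulr1 scalerA mulVf// scale1r.
apply: (@group_inverse_of_comm _ A B); first by rewrite AB BA.
by rewrite -mulrA AB mulrBr mulr1 AP subr0.
Qed.

End Poles.

Section PoleOfGroupInverse.
Context {R : realType} {X : completeNormedModType R[i]}.
Local Notation L := (bounded_op X).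
Variables (T B : L) (a : R[i]).
Local Notation A := (a *: (1 : L) - T).
Hypothesis AB : group_inverse B A.
Let P : L := 1 - A * B.
Let W (w : R[i]) : L := xget 0 [set V | is_inverse V (1 + w *: B)].
Let d : R := (2 * (opnorm B + 1))^-1.

Let b1 : 0 < opnorm B + 1.
Proof. by rewrite ltr_wpDl// opnorm_ge0. Qed.

Let d0 : 0 < d.
Proof. by rewrite invr_gt0 mulr_gt0. Qed.

Let wB_small w : normc w < d -> opnorm (- (w *: B)) <= 2^-1.
Proof.
move=> wd; rewrite opnormN opnorm_scale.
apply: (@le_trans _ _ (d * (opnorm B + 1))).
  by apply: ler_pM; rewrite ?normc_ge0 ?opnorm_ge0 ?(ltW wd)// lerDl.
by rewrite /d invfM mulfVK// gt_eqF.
Qed.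

Let half_lt1 : (2^-1 : R) < 1. Proof. lra. Qed.

Let WP w : normc w < d -> is_inverse (W w) (1 + w *: B).
Proof.
move=> wd; have [V VB] := neumann (le_lt_trans (wB_small wd) half_lt1).
rewrite opprK in VB.
exact: (@xgetPex _ 0 [set V | is_inverse V _] (ex_intro _ V VB)).
Qed.

Let W_bound w : normc w < d -> opnorm (W w) <= 2.
Proof.
move=> wd; have WI := WP wd; rewrite -[w *: B]opprK in WI.
have := inverse_1B_bound (wB_small wd) half_lt1 WI.
have -> : 1 - 2^-1 = 2^-1 :> R by lra.
by rewrite invrK.
Qed.

Let W_diff w w' : normc w < d -> normc w' < d ->
  W w' - W w = - ((w' - w) *: (W w' * B * W w)).
Proof.
move=> wd wd'; have [_ W1] := WP wd; have [W1' _] := WP wd'.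
have -> : W w' - W w = W w' * ((1 + w *: B) - (1 + w' *: B)) * W w.
  by rewrite mulrBr W1' mulrBl -mulrA W1 mulr1 mul1r.
rewrite opprD addrACA subrr add0r -scalerBl -bop_scaleAr -bop_scaleAl.
by rewrite -scaleNr opprB.
Qed.

Let AP : A * P = 0.
Proof. by case: AB => _ AAB _; rewrite mulrBr mulr1 mulrA AAB subrr. Qed.
Let PB : P * B = 0.
Proof. by case: AB => AB' _ BBA; rewrite mulrBl mul1r AB' -mulrA AB' mulrA BBA subrr. Qed.
Let BP : B * P = 0.
Proof. by case: AB => AB' _ BBA; rewrite mulrBr mulr1 AB' mulrA BBA subrr. Qed.
Let PA : P * A = 0.
Proof. by case: AB => AB' AAB _; rewrite mulrBl mul1r -mulrA -AB' mulrA AAB subrr. Qed.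
Let PW w : normc w < d -> P * W w = P.
Proof.
move=> wd; have [_ W1] := WP wd.
by rewrite -[RHS]mulr1 -W1 mulrA mulrDr mulr1 -bop_scaleAr PB scaler0 addr0.
Qed.
Let WPr w : normc w < d -> W w * P = P.
Proof.
move=> wd; have [W1 _] := WP wd.
by rewrite -[RHS]mul1r -W1 -mulrA mulrDl mul1r -bop_scaleAl BP scaler0 addr0.
Qed.

(* On the range of P = 1 - A B the operator A vanishes and w + A is w; on the
   kernel of P the operator A is invertible with inverse B and
   (w + A)^-1 = B (1 + w B)^-1 = w^-1 (1 - W w). *)
Let inverse_near w : w != 0 -> normc w < d ->
  is_inverse (w^-1 *: (P + 1 - W w)) ((a + w) *: (1 : L) - T).
Proof.
move=> w0 wd; have [W1 W2] := WP wd; have [AB' _ _] := AB.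
have -> : (a + w) *: (1 : L) - T = w *: (1 : L) + A.
  by rewrite scalerDl addrAC addrC.
have E1 : 1 - W w = w *: (B * W w).
  by rewrite -{1}W2 mulrDl mul1r -bop_scaleAl addrC addKr.
have E2 : 1 - W w = w *: (W w * B).
  by rewrite -{1}W1 mulrDr mulr1 -bop_scaleAr addrC addKr.
have AB1 : A * B = 1 - P by rewrite /P subKr.
have BA1 : B * A = 1 - P by rewrite -AB' /P subKr.
split.
  rewrite -bop_scaleAl mulrDr -bop_scaleAr mulr1 -addrA.
  rewrite [X in _ + X]mulrDl PA add0r E2 -bop_scaleAl -mulrA BA1 -scalerDr.
  rewrite scalerA mulVf// scale1r mulrBr mulr1 WPr//.
  by rewrite -E2 [P + _]addrC -addrA [P + _]addrC subrK subrK.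
rewrite -bop_scaleAr mulrDl -bop_scaleAl mul1r -addrA.
rewrite [X in _ + X]mulrDr AP add0r E1 -bop_scaleAr mulrA AB1 -scalerDr.
rewrite scalerA mulVf// scale1r mulrBl mul1r PW//.
by rewrite -E1 [P + _]addrC -addrA [P + _]addrC subrK subrK.
Qed.

Lemma group_inverse_isolated :
  exists2 e : R, 0 < e & forall z, z != a -> normc (z - a) < e -> ~ spectrum T z.
Proof.
exists d => // z za zd.
have za' : z - a != 0 by rewrite subr_eq0.
have := inverse_near za' zd; rewrite [a + _]addrC subrK; exact: not_spectrum.
Qed.

(** The numerator [P + 1 - W (z - a)] takes the value [P] at [a], which is not [0]
when [a] is in the spectrum; it is differentiable because of the resolvent-type
identity [W_diff]. *)
Lemma group_inverse_simple_pole : spectrum T a -> simple_pole_of_resolvent T a.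
Proof.
move=> sa; split; first by apply/dnear_normcP; exact: group_inverse_isolated.
exists (fun z => P + 1 - W (z - a)); split.
- apply/near_normcP; exists d => // z zd.
  apply/cvg_ex; exists (W (z - a) * B * W (z - a)).
  apply/cvg_opnormP => e e0; apply/dnear_normcP.
  pose c := 8 * opnorm B ^+ 2 + 1.
  have c0 : 0 < c by rewrite ltr_wpDl// mulr_ge0// exprn_ge0// opnorm_ge0.
  exists (Num.min (d - normc (z - a)) (e / c)).
    by rewrite lt_min subr_gt0 zd divr_gt0.
  move=> h h0; rewrite subr0 lt_min => /andP[hd hc].
  have zhd : normc (z + h - a) < d.
    rewrite addrAC; apply: (le_lt_trans (le_normcD _ _)).
    by rewrite -ltrBrDl.
  have gE : (P + 1 - W (z + h - a)) - (P + 1 - W (z - a)) =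
      h *: (W (z + h - a) * B * W (z - a)).
    have -> : (P + 1 - W (z + h - a)) - (P + 1 - W (z - a)) =
        - (W (z + h - a) - W (z - a)).
      by rewrite opprD addrACA subrr add0r opprK opprB addrC.
    by rewrite W_diff// opprK opprB addrA subrK addrAC subrr add0r.
  rewrite /= [h *: _]mulr1 (addrC h z) gE scalerA mulVf// scale1r -!mulrBl.
  have -> : W (z - a) - W (z + h - a) = h *: (W (z + h - a) * B * W (z - a)).
    by rewrite -[LHS]opprB W_diff// opprK opprB addrA subrK addrAC subrr add0r.
  have W2 := W_bound zd; have W2' := W_bound zhd.
  have B0 := opnorm_ge0 B.
  have WBW : opnorm (W (z + h - a) * B * W (z - a)) <= 2 * opnorm B * 2.
    apply: (le_trans (opnormM _ _)); apply: ler_pM; rewrite ?opnorm_ge0//.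
    by apply: (le_trans (opnormM _ _)); rewrite ler_wpM2r.
  apply: (@le_lt_trans _ _ (normc h * c)); last by rewrite -ltr_pdivlMr.
  apply: (@le_trans _ _ (normc h * (2 * opnorm B * 2) * opnorm B * 2)).
    apply: (le_trans (opnormM _ _)); apply: ler_pM; rewrite ?opnorm_ge0//.
    apply: (le_trans (opnormM _ _)); rewrite ler_wpM2r//.
    by rewrite opnorm_scale ler_wpM2l// normc_ge0.
  rewrite -!mulrA ler_wpM2l ?normc_ge0// /c expr2; lra.
- rewrite subrr => /= gP.
  have W0 : W 0 = 1.
    have := WP (w := 0); rewrite normc0 scale0r addr0 => /(_ d0)[+ _].
    by rewrite mulr1.
  have P0 : P = 0 by move: gP; rewrite W0 addrK.
  case: sa; exists B; case: AB => AB' _ _.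
  have AB1 : A * B = 1 by apply/esym/eqP; rewrite -subr_eq0; apply/eqP.
  by split => //; rewrite -AB'.
- apply/dnear_normcP; exists d => // z za zd.
  apply: resolvent_eq; rewrite expr1.
  have za' : z - a != 0 by rewrite subr_eq0.
  have := inverse_near za' zd; rewrite [a + _]addrC subrK; exact.
Qed.

End PoleOfGroupInverse.

(** * Compactness of the closed disc and of the circle *)

Section Disc.
Context {R : realType}.
Implicit Types a z w : R[i].

Lemma normc_dist z w : `|normc z - normc w| <= normc (z - w).
Proof.
have H x y : normc x - normc y <= normc (x - y).
  by rewrite lerBlDr -{1}[x](subrK y) (le_normcD (x - y)).
by rewrite ler_norml H andbT lerNl opprB -(normcN (z - w)) opprB H.
Qed.

Lemma normc_continuous : continuous (@normc R : R[i]^o -> R).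
Proof.
move=> z; apply/(@cvgrPdist_lt _ _ _ _ (nbhs_filter (z : R[i]^o))) => e e0.
apply/near_normcP; exists e => // w we.
by apply: (le_lt_trans (normc_dist _ _)); rewrite -normcN opprB.
Qed.

(** The disc is a closed part of the square of side 2, a continuous image of a
product of two segments. *)
Lemma closed_disc_compact : compact [set z : R[i]^o | normc z <= 1].
Proof.
pose f (p : R * R) : R[i]^o := p.1 +i* p.2.
have cf : continuous f.
  move=> p; apply/cvgrPdist_lt => e /ltCR0[r r0 ->].
  have r2 : 0 < r / 2 by rewrite divr_gt0.
  exists (ball p.1 (r / 2), ball p.2 (r / 2)) => [|q /= [q1 q2]].
    by split; exact: nbhsx_ballx.
  rewrite normr_normc ltcR.
  have -> : f p - f q = (p.1 - q.1)%:C + 'i * (p.2 - q.2)%:C.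
    by apply/eqP; rewrite eq_complex /=; apply/andP; split; apply/eqP; ring.
  apply: (le_lt_trans (le_normcD _ _)).
  have ni : normc ('i : R[i]) = 1 by rewrite /= expr0n expr1n add0r sqrtr1.
  by rewrite normcM ni mul1r !normc_real [ltRHS]splitr ltrD.
have cK : compact (f @` (`[-1, 1] `*` `[-1, 1])).
  apply: continuous_compact; first exact: continuous_subspaceT.
  by apply: compact_setX; exact: segment_compact.
apply: (subclosed_compact _ cK).
  apply: (@closed_comp _ _ (@normc R : R[i]^o -> R) [set x | x <= 1]) => [z _|].
    exact: normc_continuous.
  exact: closed_le.
move=> z /= z1; exists (complex.Re z, complex.Im z); last by case: (z).
have z2 : normc z ^+ 2 <= 1 by rewrite expr_le1 ?normc_ge0.
have : complex.Re z ^+ 2 + complex.Im z ^+ 2 <= 1.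
  case: z z2 {z1} => x y /=; rewrite sqr_sqrtr// addr_ge0 ?sqr_ge0//.
move=> H; split; rewrite /= in_itv /= -ler_norml -(@expr_le1 _ 2) ?real_normK ?num_real//.
  by apply: le_trans H; rewrite lerDl sqr_ge0.
by apply: le_trans H; rewrite lerDr sqr_ge0.
Qed.

Lemma unit_circle_compact : compact ([set z | normc z = 1] : set R[i]^o).
Proof.
apply: (subclosed_compact _ closed_disc_compact); last by move=> z /= ->.
apply: (@closed_comp _ _ (@normc R : R[i]^o -> R) [set x | x = 1]) => [z _|].
  exact: normc_continuous.
exact: closed_eq.
Qed.

End Disc.

(** * Spectrum in the open disc and decay of the powers *)

Section DiscResolvent.
Context {R : realType} {X : completeNormedModType R[i]}.
Local Notation L := (bounded_op X).
Implicit Types (S T U V A B P : L) (a z : R[i]).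

(** Around each [a] of the disc the perturbation formula
[1 - z *: S = (1 - a *: S) * (1 - (z - a) *: (V0 * S))] bounds the inverses by
twice the norm of the one at [a]; compactness makes the bound global. *)
Lemma disc_inverse_bounded S :
  (forall z, normc z <= 1 -> exists V, is_inverse V (1 - z *: S)) ->
  exists2 M : R, 0 < M & forall z V, normc z <= 1 ->
    is_inverse V (1 - z *: S) -> opnorm V <= M.
Proof.
move=> HS.
pose Q (M : R) (z : R[i]^o) := forall V, is_inverse V (1 - z *: S) -> opnorm V <= M.
suff H : \forall M \near +oo, [set z : R[i]^o | normc z <= 1] `<=` Q M.
  have [M [M0 HM]] := filter_ex (filterI (nbhs_pinfty_gt (num_real (0 : R))) H).
  by exists M => // z V z1 VS; exact: (HM z z1 V VS).
have /compact_near_coveringP near_disc := @closed_disc_compact R.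
apply: near_disc => a /= /HS[V0 [V0S SV0]].
pose b := opnorm (V0 * S) + 1.
have b0 : 0 < b by rewrite ltr_wpDl// opnorm_ge0.
exists ([set z : R[i]^o | normc (z - a) < (2 * b)^-1], [set M | 2 * opnorm V0 < M]).
  split; last exact: nbhs_pinfty_gt (num_real _).
  by apply/near_normcP; exists (2 * b)^-1; rewrite ?invr_gt0 ?mulr_gt0.
move=> [z M] /= [za HM] V [_ VS].
have small : opnorm ((z - a) *: (V0 * S)) <= 2^-1.
  rewrite opnorm_scale; apply: (@le_trans _ _ ((2 * b)^-1 * b)).
    by apply: ler_pM; rewrite ?normc_ge0 ?opnorm_ge0 ?(ltW za)// lerDl.
  by rewrite invfM mulfVK// gt_eqF.
have E : V0 * (1 - z *: S) = 1 - (z - a) *: (V0 * S).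
  have -> : 1 - z *: S = 1 - a *: S - (z - a) *: S.
    by rewrite scalerBl opprB addrA subrK.
  by rewrite mulrBr V0S bop_scaleAr.
have half_lt1 : (2^-1 : R) < 1 by lra.
have := opnorm_1B V small half_lt1.
rewrite -E -mulrA VS mulr1 => H; apply: (le_trans H).
have -> : 1 - 2^-1 = 2^-1 :> R by lra.
by rewrite invrK mulrC ltW.
Qed.

Lemma sub_inverse S T U V : is_inverse U S -> is_inverse V T ->
  U - V = U * (T - S) * V.
Proof.
by move=> [US SU] [VT TV]; rewrite mulrBr mulrBl -mulrA TV mulr1 US mul1r.
Qed.

(** Partial fractions for [1 / (1 - x ^+ 2)]. *)
Lemma inverse_1B_sqr S U V : is_inverse U (1 - S) -> is_inverse V (1 + S) ->
  is_inverse ((2^-1 : R[i]) *: (U + V)) (1 - S * S).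
Proof.
move=> [US SU] [VS SV].
have E1 : (1 - S) * (1 + S) = 1 - S * S.
  by rewrite mulrDr mulr1 mulrBl mul1r addrA subrK.
have E2 : (1 + S) * (1 - S) = 1 - S * S.
  by rewrite mulrBr mulr1 mulrDl mul1r opprD addrA addrK.
have two : (2^-1 : R[i]) *: (1 + S + (1 - S)) = 1.
  rewrite addrACA subrr addr0 -[1 + 1]/(1 *+ 2) -(@scaler_nat R[i] L).
  by rewrite scalerA mulVf ?scale1r// pnatr_eq0.
split.
  rewrite -bop_scaleAl mulrDl -{1}E1 -E2 !mulrA US VS !mul1r; exact: two.
rewrite -bop_scaleAr mulrDr -{1}E2 -E1 -!mulrA SU SV !mulr1; exact: two.
Qed.

(** The inverse of [1 - (z *: S) ^+ (2 ^ k.+1)] is the mean of those of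
[1 - (z *: S) ^+ (2 ^ k)] and [1 + (z *: S) ^+ (2 ^ k)], and the second is the
first at the rotated point [h * z], where [h ^+ (2 ^ k) = -1].  As rotations
keep distances, the Lipschitz constant is the same at all levels. *)
Lemma dyadic_disc_lipschitz S (c : R) :
  (forall z w, normc z <= 1 -> normc w <= 1 -> exists U V,
     [/\ is_inverse U (1 - z *: S), is_inverse V (1 - w *: S) &
         opnorm (U - V) <= c * normc (z - w)]) ->
  forall k z w, normc z <= 1 -> normc w <= 1 -> exists U V,
     [/\ is_inverse U (1 - (z *: S) ^+ (2 ^ k)),
         is_inverse V (1 - (w *: S) ^+ (2 ^ k)) &
         opnorm (U - V) <= c * normc (z - w)].
Proof.
move=> H; elim=> [|k IH] z w z1 w1; first by rewrite expn0 !expr1; exact: H.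
have k0 : (0 < 2 ^ k)%N by rewrite expn_gt0.
pose h : R[i] := (2 ^ k).-root (- 1).
have hk : h ^+ (2 ^ k) = -1 by rewrite rootCK.
have h1 : normc h = 1.
  apply/eqP; rewrite -(@pexpr_eq1 _ _ (2 ^ k)) ?normc_ge0//.
  by rewrite -normcX hk normcN normc1.
have hS a : (h * a *: S) ^+ (2 ^ k) = - (a *: S) ^+ (2 ^ k).
  rewrite -scalerA; have exprZ m : (h *: (a *: S)) ^+ m = h ^+ m *: (a *: S) ^+ m.
    elim: m => [|m IHm]; first by rewrite !expr0 scale1r.
    by rewrite !exprS IHm -bop_scaleAl -bop_scaleAr scalerA.
  by rewrite exprZ hk scaleN1r.
have [U1 [V1 [U1z V1w UV1]]] := IH z w z1 w1.
have [||U2 [V2 [U2z V2w UV2]]] := IH (h * z) (h * w).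
- by rewrite normcM h1 mul1r.
- by rewrite normcM h1 mul1r.
rewrite hS opprK in U2z; rewrite hS opprK in V2w.
have sq a : (a *: S) ^+ (2 ^ k.+1) = (a *: S) ^+ (2 ^ k) * (a *: S) ^+ (2 ^ k).
  by rewrite expnS mul2n -addnn exprD.
exists ((2^-1 : R[i]) *: (U1 + U2)), ((2^-1 : R[i]) *: (V1 + V2)); rewrite !sq; split.
- exact: (inverse_1B_sqr U1z U2z).
- exact: (inverse_1B_sqr V1w V2w).
rewrite -scalerBr opnorm_scale normcV normc_nat opprD addrACA.
rewrite [leLHS]mulrC ler_pdivrMr//; apply: (le_trans (opnormDr _ _)).
rewrite -mulrBr normcM h1 mul1r in UV2.
by rewrite mulr_natr mulr2n lerD.
Qed.

Lemma opnorm_inverse_sub1 S V q : opnorm S <= q -> q < 1 ->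
  is_inverse V (1 - S) -> opnorm (V - 1) <= q / (1 - q).
Proof.
move=> Sq q1 VS; have [VS1 _] := VS.
have -> : V - 1 = V * S by rewrite -{1}VS1 mulrBr mulr1 subKr.
apply: (le_trans (opnormM _ _)); rewrite mulrC.
by apply: ler_pM; rewrite ?opnorm_ge0//; exact: inverse_1B_bound VS.
Qed.

(** Let [t] go from [0] to [1] in [J] equal steps, asserting at each step that some
dyadic power of [t *: S] is a contraction.  At a given step take the dyadic
exponent so large that the inverse [U] of [1 - (t *: S) ^+ (2 ^ k)] is within
[1 / 7] of [1].  By the Lipschitz bound, uniform in [k], the corresponding
inverse [V] at the next step is within [1 / 8] of [U], hence within [1 / 3] of
[1], which forces the power of [S] inside to have norm at most [1 / 2]. *)
Lemma disc_power_contraction S :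
  (forall z, normc z <= 1 -> exists V, is_inverse V (1 - z *: S)) ->
  exists2 m, (0 < m)%N & opnorm (S ^+ m) < 1.
Proof.
move=> HS; have [M M0 HM] := disc_inverse_bounded HS.
pose c := M * opnorm S * M.
have Lip : forall z w, normc z <= 1 -> normc w <= 1 -> exists U V,
     [/\ is_inverse U (1 - z *: S), is_inverse V (1 - w *: S) &
         opnorm (U - V) <= c * normc (z - w)].
  move=> z w z1 w1; have [U Uz] := HS z z1; have [V Vw] := HS w w1.
  exists U, V; split=> //; rewrite (sub_inverse Uz Vw).
  have -> : 1 - w *: S - (1 - z *: S) = (z - w) *: S.
    by rewrite opprB addrC addrA subrK -scalerBl.
  rewrite -bop_scaleAr -bop_scaleAl opnorm_scale mulrC ler_wpM2r ?normc_ge0//.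
  apply: (le_trans (opnormM _ _)); apply: ler_pM; rewrite ?opnorm_ge0//.
    by apply: (le_trans (opnormM _ _)); rewrite ler_wpM2r ?opnorm_ge0// (HM z).
  exact: HM Vw.
have {}Lip := dyadic_disc_lipschitz Lip.
have c0 : 0 <= c by rewrite !mulr_ge0 ?opnorm_ge0// ltW.
(* J is chosen so that one step of length 1 / J moves the inverses by at most 1 / 8. *)
pose J := (Num.bound (8 * c)).+1.
have J0 : 0 < J%:R :> R by rewrite ltr0n.
have cJ : c / J%:R <= 8^-1.
  rewrite ler_pdivrMr// mulrC ler_pdivlMr// mulrC ltW//.
  apply: (@lt_trans _ _ (Num.bound (8 * c))%:R); last by rewrite ltr_nat.
  by apply: archi_boundP; rewrite mulr_ge0.
pose t j : R[i] := (j%:R / J%:R)%:C.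
have t1 j : (j <= J)%N -> normc (t j) <= 1.
  move=> jJ; rewrite normc_real ger0_norm ?divr_ge0//.
  by rewrite ler_pdivrMr// mul1r ler_nat.
suff H j : (j <= J)%N -> exists k, opnorm ((t j *: S) ^+ (2 ^ k)) < 1.
  have [k Hk] := H J (leqnn J); exists (2 ^ k)%N; first by rewrite expn_gt0.
  by move: Hk; rewrite /t divff ?gt_eqF// scale1r.
elim: j => [_|j IH jJ].
  by exists 0; rewrite /t mul0r scale0r expn0 expr1 opnorm0 ltr01.
have [k Hk] := IH (ltnW jJ).
have [i Hi] : exists i, opnorm ((t j *: S) ^+ (2 ^ (k + i))) <= 8^-1.
  have e8 : 0 < 8^-1 :> R by rewrite invr_gt0.
  have [i H] := exprn_small (opnorm_ge0 _) Hk e8.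
  exists i; rewrite expnD exprM; apply: (le_trans (opnormX _ _)); rewrite ltW//.
  by apply: H; apply: ltnW; exact: ltn_expl.
exists (k + i)%N.
have [U [V [Uj Vj UV]]] := Lip (k + i)%N (t j) (t j.+1) (t1 j (ltnW jJ)) (t1 _ jJ).
have lt81 : (8^-1 : R) < 1 by lra.
have U1 := opnorm_inverse_sub1 Hi lt81 Uj.
have dt : normc (t j - t j.+1) = J%:R^-1.
  rewrite /t -rmorphB normc_real -mulrBl -natr1 opprD addrA subrr add0r.
  by rewrite mulN1r normrN ger0_norm// invr_ge0 ltW.
rewrite dt in UV.
have V1 : opnorm (V - 1) <= 3^-1.
  have q7 : 8^-1 / (1 - 8^-1) <= 7^-1 :> R by rewrite ler_pdivrMr; lra.
  have UV8 := le_trans UV cJ; have U7 := le_trans U1 q7.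
  apply: (le_trans (opnorm_triangle U V 1)); rewrite (opnormB V U).
  by apply: (le_trans (lerD UV8 U7)); lra.
have [_ Vj2] := Vj; set y := (t j.+1 *: S) ^+ _ in Vj Vj2 *.
have E : y = (1 - y) * (V - 1) by rewrite mulrBr Vj2 mulr1 subKr.
have Ny : opnorm y <= opnorm (1 - y) * 3^-1.
  by rewrite {1}E; apply: (le_trans (opnormM _ _)); rewrite ler_wpM2l ?opnorm_ge0.
have := opnorm_sub 1 y; have := @opnorm1 _ X; lra.
Qed.

Lemma power_cvg0 S m : (0 < m)%N -> opnorm (S ^+ m) < 1 ->
  (fun n => S ^+ n) @ \oo --> (0 : L).
Proof.
move=> m0 Sm; apply/cvgn_opnormP => e e0.
pose C := (opnorm S + 1) ^+ m.
have S1 : 1 <= opnorm S + 1 by rewrite lerDr opnorm_ge0.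
have C0 : 0 < C by rewrite exprn_gt0// (lt_le_trans ltr01).
have [n0 H] := exprn_small (opnorm_ge0 _) Sm (divr_gt0 e0 C0).
exists (n0 * m)%N => n nn; rewrite sub0r opnormN (divn_eq n m) exprD mulnC exprM.
apply: (le_lt_trans (opnormM _ _)).
apply: (@le_lt_trans _ _ (opnorm (S ^+ m) ^+ (n %/ m) * C)); last first.
  by rewrite -ltr_pdivlMr// H// leq_divRL.
apply: ler_pM; rewrite ?opnorm_ge0 ?opnormX//.
apply: (le_trans (opnormX _ _)); apply: (@le_trans _ _ ((opnorm S + 1) ^+ (n %% m))).
  by rewrite lerXn2r ?nnegrE ?opnorm_ge0 ?(le_trans ler01 S1)// lerDl.
by rewrite ler_weXn2l// ltnW// ltn_mod.
Qed.

End DiscResolvent.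

(** * Deflation of the peripheral spectrum *)

Section Peripheral.
Context {R : realType} {X : completeNormedModType R[i]}.
Local Notation L := (bounded_op X).
Implicit Types (S T U V A B P Q : L) (a z : R[i]).

(** Spectral values and regular points are treated alike: an inverse is a group
inverse. *)
Definition peripheral_group_inverses T :=
  forall z, normc z = 1 -> exists B, group_inverse B (z *: (1 : L) - T).

Lemma unit_circleE a : unit_circle a <-> normc a = 1.
Proof.
rewrite /unit_circle /= normr_normc; split=> [|->//].
by move=> /(congr1 (@complex.Re R)).
Qed.

(** Each point of the circle has a neighbourhood that contains no other spectral
value; finitely many of these cover the circle. *)
Lemma peripheral_spectrum_finite T : peripheral_group_inverses T ->
  finite_set (spectrum T `&` unit_circle).
Proof.
move=> HT.
have iso a : exists e : R, 0 < e /\ (normc a = 1 ->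
    forall z, z != a -> normc (z - a) < e -> ~ spectrum T z).
  have [a1|a1] := pselect (normc a = 1); last by exists 1.
  have [B /group_inverse_isolated[e e0 H]] := HT a a1.
  by exists e; split.
pose r a := sval (cid (iso a)).
have r0 a : 0 < r a by rewrite /r; case: cid => /= ? [].
have rP a : normc a = 1 -> forall z, z != a -> normc (z - a) < r a -> ~ spectrum T z.
  by rewrite /r; case: cid => /= ? [].
pose C : set R[i]^o := [set z | normc z = 1].
have : cover_compact C by rewrite -compact_cover; exact: unit_circle_compact.
pose U a : set R[i]^o := [set z | normc (z - a) < r a].
move=> /(_ R[i]^o C U) covC.
have [D sD HD] : finite_subset_cover C U C.
  apply: covC => [a _|a Ca]; last by exists a => //; rewrite /U /= subrr normc0.
  rewrite openE => z /= za; apply/near_normcP.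
  exists (r a - normc (z - a)); first by rewrite subr_gt0.
  move=> w wz; rewrite /U /= -[w - a](subrKA z) (le_lt_trans (le_normcD _ _))//.
  by rewrite -ltrBrDr.
apply: (sub_finite_set _ (finite_fset D)).
move=> z [sz /unit_circleE z1]; have [a aD za] := HD z z1.
have [->//|zna] := eqVneq z a.
have a1 : normc a = 1 by have := sD a aD; rewrite inE.
by case: (rP a a1 z zna za).
Qed.

(** The elements [U * Q + c *: (1 - Q)] act as [U] on the range of [Q] and as the
scalar [c] on its kernel, so they multiply componentwise. *)
Lemma corner_mul Q U U' (c c' : R[i]) : Q * Q = Q ->
  GRing.comm U' Q ->
  (U * Q + c *: (1 - Q)) * (U' * Q + c' *: (1 - Q)) =
  U * U' * Q + (c * c') *: (1 - Q).
Proof.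
move=> QQ U'Q.
have Q1 : Q * (1 - Q) = 0 by rewrite mulrBr mulr1 QQ subrr.
have Q2 : (1 - Q) * Q = 0 by rewrite mulrBl mul1r QQ subrr.
have Q3 : (1 - Q) * (1 - Q) = 1 - Q by rewrite mulrBl mul1r Q1 subr0.
rewrite mulrDl !mulrDr -!bop_scaleAl -!bop_scaleAr scalerA.
rewrite U'Q !mulrA Q2 Q3 mul0r scaler0 add0r.
rewrite -(mulrA U Q Q) QQ -(mulrA U Q (1 - Q)) Q1 mulr0 scaler0 addr0.
by rewrite -(mulrA U Q U') -U'Q mulrA.
Qed.

Section Deflation.
Variables (T B : L) (a : R[i]).
Local Notation A := (a *: (1 : L) - T).
Hypothesis AB : group_inverse B A.
Let Q := A * B.

Lemma deflation_comm V : GRing.comm V T -> GRing.comm V Q.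
Proof.
move=> VT; have VA : GRing.comm V A by exact: comm_shift.
exact: commrM (group_inverse_comm AB VA).
Qed.

Let QQ : Q * Q = Q.
Proof.
rewrite /Q; case: AB => {1}-> AAB _.
by rewrite -(mulrA B) (mulrA A) AAB; case: AB.
Qed.

Let AQ : A * Q = A.
Proof. by rewrite /Q mulrA; case: AB. Qed.

Let TQ : T * (1 - Q) = a *: (1 - Q).
Proof.
apply/eqP; rewrite eq_sym -subr_eq0 -{1}[1 - Q]mul1r bop_scaleAl -mulrBl.
by rewrite mulrBr mulr1 AQ subrr.
Qed.

Let split_T : T = T * Q + a *: (1 - Q).
Proof. by rewrite -TQ -mulrDr addrC subrK mulr1. Qed.

Let shift_deflation z : z *: (1 : L) - T * Q =
  (z *: (1 : L) - T) * Q + z *: (1 - Q).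
Proof. by rewrite mulrBl -bop_scaleAl mul1r scalerBr [RHS]addrC addrA subrK. Qed.

Let comm_TQ : GRing.comm T Q.
Proof. exact: deflation_comm. Qed.

(** [z - T * Q] acts as [z - T] on the range of [Q] and as [z] on its kernel.  An
inverse of [z - T] can be used on the range of [Q]; for [z = a] the group
inverse [B] can, since [A * B] is the identity there. *)
Lemma deflation_spectrum z : z != 0 -> spectrum (T * Q) z -> spectrum T z /\ z <> a.
Proof.
move=> z0 sz.
have key V : GRing.comm V T -> (z *: (1 : L) - T) * V * Q = Q ->
    V * (z *: (1 : L) - T) * Q = Q -> False.
  move=> VT E1 E2; apply: sz; exists (V * Q + z^-1 *: (1 - Q)).
  have cVQ := deflation_comm VT.
  have czQ : GRing.comm (z *: (1 : L) - T) Q.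
    by apply: deflation_comm; apply: commr_sym; exact: comm_shift (commr_refl T).
  rewrite shift_deflation; split.
    by rewrite corner_mul// E2 mulVf// scale1r addrC subrK.
  by rewrite corner_mul// E1 mulfV// scale1r addrC subrK.
split.
  move=> [V [VT1 VT2]]; apply: (key V); rewrite ?VT1 ?VT2 ?mul1r//.
  apply: commr_sym; apply: (is_inverse_comm (conj VT1 VT2)).
  exact: comm_shift (commr_refl T).
move=> za; subst z; have cTB : GRing.comm T B.
  by apply: (group_inverse_comm AB); exact: comm_shift (commr_refl T).
apply: (key B); rewrite ?QQ//.
by case: AB => <- _ _; exact: QQ.
Qed.

Lemma deflation_group_inverses : peripheral_group_inverses T ->
  peripheral_group_inverses (T * Q).
Proof.
move=> HT z z1; have [V VT] := HT z z1.
have z0 : z != 0.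
  by apply/eqP => z0; move: z1; rewrite z0 normc0 => /esym/eqP; rewrite oner_eq0.
have cTV : GRing.comm V T.
  by apply: commr_sym; apply: (group_inverse_comm VT); exact: comm_shift (commr_refl T).
have cVQ := deflation_comm cTV.
have czQ : GRing.comm (z *: (1 : L) - T) Q.
  by apply: deflation_comm; apply: commr_sym; exact: comm_shift (commr_refl T).
exists (V * Q + z^-1 *: (1 - Q)); rewrite shift_deflation.
case: VT => E1 E2 E3; split; rewrite !corner_mul//.
- by rewrite E1 mulfV// mulVf.
- by rewrite E2 mulfK.
- by rewrite E3 mulfVK.
Qed.

Lemma deflation_power n : T ^+ n.+1 = (T * Q) ^+ n.+1 + a ^+ n.+1 *: (1 - Q).
Proof.
have E m : T ^+ m = T ^+ m * Q + a ^+ m *: (1 - Q).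
  elim: m => [|m IH]; first by rewrite !expr0 mul1r scale1r addrC subrK.
  rewrite [LHS]exprS [X in X * _]split_T {1}IH corner_mul//.
    by rewrite -!exprS.
  by apply: commr_sym; apply: commrX; exact: commr_sym.
rewrite [LHS]E exprMn_comm//; congr (_ * _ + _).
by elim: n => [|n IH]; rewrite ?expr1// exprS -IH QQ.
Qed.

End Deflation.

End Peripheral.

(** * Compact orbits *)

Section Orbits.
Context {R : realType} {X : completeNormedModType R[i]}.
Local Notation L := (bounded_op X).
Implicit Types (S T U V A B P Q : L) (a z : R[i]).

(** A neighbourhood of the limit absorbs all but finitely many terms. *)
Lemma cvg_sequence_compact (u : nat -> L) (l : L) :
  u @ \oo --> l -> compact ([set l] `|` range u).
Proof.
move=> ul; apply/compact_near_coveringP => I F K FF HK.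
have [[U1 U2] /= [U1l FU2] HU] := HK l (or_introl erefl).
have [n0 _ Hn0] := ul U1 U1l.
have fin : compact (u @` [set n | (n < n0)%N]).
  by apply/finite_compact/finite_image; exact: finite_II.
have near_fin : \forall i \near F, (u @` [set n | (n < n0)%N]) `<=` K i.
  move/compact_near_coveringP: fin => near_fin.
  by apply: near_fin => _ [n _ <-]; apply: HK; right; exists n.
apply: filterS (filterI near_fin FU2) => i [finK U2i] x [->|[n _ <-]].
  by apply: (HU (l, i)); split => //; exact: nbhs_singleton.
have [nn0|nn0] := ltnP n n0; first by apply: finK; exists n.
by apply: (HU (u n, i)); split => //; exact: Hn0.
Qed.

(** Induction on a list [s] of points containing the peripheral spectrum, each step
removing one point by deflation. *)
Lemma power_orbit_compact (s : seq R[i]) T :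
  (forall z, spectrum T z -> normc z <= 1) -> peripheral_group_inverses T ->
  (forall z, z \in s -> normc z = 1) ->
  (forall z, spectrum T z -> normc z = 1 -> z \in s) ->
  exists2 K : set L, compact K & forall n, K (T ^+ n).
Proof.
elim: s T => [|a s IH] T T1 HT s1 sT.
  have [m m0 Tm] : exists2 m, (0 < m)%N & opnorm (T ^+ m) < 1.
    apply: disc_power_contraction => z z1.
    have [->|z0] := eqVneq z 0.
      by exists 1; split; rewrite scale0r subr0 mulr1.
    have [V VT] : exists V, is_inverse V (z^-1 *: (1 : L) - T).
      apply: contrapT => sz; have sz1 := T1 _ sz.
      suff : z^-1 \in [::] by [].
      apply: sT => //; apply/eqP; rewrite eq_le sz1 normcV invf_ge1//.
      by rewrite lt_neqAle normc_ge0 andbT eq_sym; apply: contra_neq z0 => /eq0_normc.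
    exists (z^-1 *: V); have := is_inverse_scale z0 VT.
    by rewrite scalerBr scalerA mulfV// scale1r.
  exists ([set (0 : L)] `|` range (fun n => T ^+ n)); last by right; exists n.
  exact: cvg_sequence_compact (power_cvg0 m0 Tm).
have a1 : normc a = 1 by apply: s1; rewrite mem_head.
have a0 : a != 0.
  by apply/eqP => a0; move: a1; rewrite a0 normc0 => /esym/eqP; rewrite oner_eq0.
have [B AB] := HT a a1.
pose Q := (a *: (1 : L) - T) * B.
have [||||K cK TK] := IH (T * Q).
- move=> z sz; have [->|z0] := eqVneq z 0; first by rewrite normc0.
  by apply: T1; have [] := deflation_spectrum AB z0 sz.
- exact: deflation_group_inverses.
- by move=> z zs; apply: s1; rewrite in_cons zs orbT.
- move=> z sz z1; have z0 : z != 0.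
    by apply/eqP => z0; move: z1; rewrite z0 normc0 => /esym/eqP; rewrite oner_eq0.
  have [sz' /eqP za] := deflation_spectrum AB z0 sz.
  by have := sT z sz' z1; rewrite in_cons (negPf za).
pose f (p : L * R[i]^o) : L := p.1 + p.2 *: (1 - Q).
have cf : continuous f.
  move=> p; apply: cvgD; first exact: cvg_fst.
  by apply: cvgZr_tmp; exact: cvg_snd.
exists ([set (1 : L)] `|` f @` (K `*` ([set z | normc z = 1] : set R[i]^o))).
  apply: compactU; first exact: compact_set1.
  apply: continuous_compact; first exact: continuous_subspaceT.
  by apply: compact_setX => //; exact: unit_circle_compact.
move=> [|n]; first by left; rewrite /= expr0.
right; exists ((T * Q) ^+ n.+1, a ^+ n.+1).
  by split => /=; [exact: TK|rewrite normcX a1 expr1n].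
by rewrite /f /= -deflation_power.
Qed.

Lemma near_opnorm V (e : R) : 0 < e -> \forall V' \near V, opnorm (V - V') < e.
Proof.
by have /cvg_opnormP H : id @ V --> V by [exact: cvg_id]; exact: H.
Qed.

(** The bound [N] is uniform in [n].  A point of [K] near some [u k] has a
neighbourhood in which [k] serves for every term of the sequence; any other
point has a neighbourhood free of terms. *)
Lemma orbit_net (K : set L) (u : nat -> L) (e : R) :
  compact K -> (forall n, K (u n)) -> 0 < e ->
  exists N, forall n, exists2 k, (k <= N)%N & opnorm (u n - u k) < e.
Proof.
move=> cK uK e0.
pose P (N : nat) (V : L) := forall n, u n = V ->
  exists2 k, (k <= N)%N & opnorm (u n - u k) < e.
suff H : \forall N \near \oo, K `<=` P N.
  by have [N HN] := filter_ex H; exists N => n; exact: (HN _ (uK n)).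
move/compact_near_coveringP: cK => near_K.
apply: near_K => V KV.
have [[k Vk]|noV] := pselect (exists k, opnorm (V - u k) < e / 2).
  have : \forall V' \near V, opnorm (V - V') < e / 2.
    by apply: near_opnorm; rewrite divr_gt0.
  move=> nV; exists ([set V' | opnorm (V - V') < e / 2], [set N | (k <= N)%N]).
    by split => //; exists k.
  move=> [V' N] /= [V'V kN] n nV'; exists k => //; rewrite nV'.
  by apply: (le_lt_trans (opnorm_triangle V _ _)); rewrite [ltRHS]splitr ltrD// opnormB.
have nV : \forall V' \near V, opnorm (V - V') < e / 2.
  by apply: near_opnorm; rewrite divr_gt0.
exists ([set V' | opnorm (V - V') < e / 2], setT); first by split => //; exact: filterT.
move=> [V' N] /= [V'V _] n nV'; case: noV; exists n; rewrite nV'//.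
Qed.

Lemma opnorm_cesaro S C N : 0 <= C -> (forall n, opnorm (S ^+ n) <= C) ->
  opnorm (cesaro_mean S N) <= C.
Proof.
move=> C0 SC; have [->|N0] := posnP N.
  by rewrite /cesaro_mean invr0 scale0r opnorm0.
rewrite opnorm_scale normc_natV mulrC ler_pdivrMr ?ltr0n//.
apply: (le_trans (opnorm_sum _ _ _)).
apply: (@le_trans _ _ (\sum_(1 <= k < N.+1) C)); first exact: ler_sum.
by rewrite sumr_const_nat subn1 /= mulr_natr.
Qed.

Lemma cesaro_comm S T n : GRing.comm T S -> GRing.comm T (cesaro_mean S n).
Proof.
by move=> TS; apply: comm_scale; apply: commr_sum => k _; exact: commrX.
Qed.

(** Each factor [S] costs [2 * C ^+ 2 / N] by the telescoping identity
[mul_1B_cesaro]. *)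
Lemma cesaro_absorb S C N k : 0 <= C -> (forall n, opnorm (S ^+ n) <= C) ->
  (0 < N)%N ->
  opnorm (cesaro_mean S N * S ^+ k - cesaro_mean S N) <= k%:R * (2 * C ^+ 2 / N%:R).
Proof.
move=> C0 SC N0; elim: k => [|k IH].
  by rewrite expr0 mulr1 subrr opnorm0 mul0r.
apply: (le_trans (opnorm_triangle (cesaro_mean S N * S ^+ k) _ _)).
rewrite -natr1 mulrDl mul1r addrC lerD//.
have -> : cesaro_mean S N * S ^+ k.+1 - cesaro_mean S N * S ^+ k =
    - ((1 - S) * cesaro_mean S N * S ^+ k).
  have cS : GRing.comm S (cesaro_mean S N) by exact: cesaro_comm.
  by rewrite exprS mulrA -cS !mulrBl mul1r opprB.
rewrite opnormN mul_1B_cesaro -bop_scaleAl opnorm_scale normc_natV.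
rewrite mulrC ler_wpM2r ?invr_ge0//.
apply: (le_trans (opnormM _ _)).
have H1 : opnorm (S - S ^+ N.+1) <= 2 * C.
  apply: (le_trans (opnorm_sub _ _)); rewrite -[X in opnorm X + _]expr1.
  by rewrite mulr_natl mulr2n lerD.
rewrite expr2 mulrA; apply: ler_pM; rewrite ?opnorm_ge0//.
Qed.

Lemma orbit_bounded (K : set L) (u : nat -> L) :
  compact K -> (forall n, K (u n)) ->
  exists2 C : R, 0 < C & forall n, opnorm (u n) <= C.
Proof.
move=> cK uK; have [N HN] := orbit_net cK uK ltr01.
pose C := \sum_(k < N.+1) opnorm (u k) + 1; exists C.
  by rewrite ltr_wpDl// sumr_ge0// => k _; exact: opnorm_ge0.
move=> n; have [k kN nk] := HN n.
rewrite -[u n](subrK (u k)) addrC (le_trans (opnormDr _ _))// /C lerD ?(ltW nk)//.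
rewrite (bigD1 (Ordinal (kN : (k < N.+1)%N)))//= lerDl sumr_ge0// => i _.
exact: opnorm_ge0.
Qed.

Lemma orbit_compact_ergodic S (K : set L) :
  compact K -> (forall n, K (S ^+ n)) -> uniformly_ergodic S.
Proof.
move=> cK SK.
have [C C0 SC] := orbit_bounded cK SK.
apply/uniformly_ergodicP/bop_complete => e e0.
pose d := e / (4 * C); have d0 : 0 < d by rewrite divr_gt0// mulr_gt0.
have [N HN] := orbit_net cK SK d0.
pose D := N%:R * (2 * C ^+ 2).
have absorb m n : (0 < m)%N ->
    opnorm (cesaro_mean S m * S ^+ n - cesaro_mean S m) <= e / 4 + D / m%:R.
  move=> m0; have [k kN nk] := HN n.
  have -> : cesaro_mean S m * S ^+ n - cesaro_mean S m =
      cesaro_mean S m * (S ^+ n - S ^+ k) + (cesaro_mean S m * S ^+ k - cesaro_mean S m).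
    by rewrite mulrBr addrA subrK.
  apply: (le_trans (opnormDr _ _)); rewrite lerD//.
    apply: (le_trans (opnormM _ _)); apply: (@le_trans _ _ (C * d)).
      by apply: ler_pM; rewrite ?opnorm_ge0 ?(ltW nk)// opnorm_cesaro// ltW.
    have -> : C * d = e / 4; last exact: lexx.
    by rewrite /d; field; rewrite gt_eqF.
  apply: (le_trans (cesaro_absorb k (ltW C0) SC m0)).
  rewrite /D -[X in _ <= X]mulrA ler_wpM2r ?ler_nat//.
  by rewrite divr_ge0// mulr_ge0// exprn_ge0// ltW.
have absorb_mean m n : (0 < m)%N -> (0 < n)%N ->
    opnorm (cesaro_mean S m * cesaro_mean S n - cesaro_mean S m) <= e / 4 + D / m%:R.
  move=> m0 n0.
  have -> : cesaro_mean S m * cesaro_mean S n - cesaro_mean S m =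
      (n%:R^-1 : R[i]) *: \sum_(1 <= k < n.+1) (cesaro_mean S m * S ^+ k - cesaro_mean S m).
    rewrite sumrB -mulr_sumr sumr_const_nat subn1 /= scalerBr bop_scaleAr.
    rewrite -(@scaler_nat R[i] L) scalerA mulVf ?scale1r// pnatr_eq0 -lt0n//.
  rewrite opnorm_scale normc_natV mulrC ler_pdivrMr ?ltr0n//.
  apply: (le_trans (opnorm_sum _ _ _)).
  apply: (@le_trans _ _ (\sum_(1 <= k < n.+1) (e / 4 + D / m%:R))).
    by apply: ler_sum => k _; exact: absorb.
  by rewrite sumr_const_nat subn1 /= mulr_natr.
have D0 : 0 <= D by rewrite mulr_ge0// mulr_ge0// exprn_ge0// ltW.
pose M := (Num.bound (8 * D / e)).+1.
have DM m : (M <= m)%N -> D / m%:R < e / 8.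
  move=> Mm; have m0 : 0 < m%:R :> R by rewrite ltr0n (leq_trans _ Mm).
  rewrite ltr_pdivrMr//.
  have H : 8 * D / e < m%:R.
    apply: (@lt_le_trans _ _ (Num.bound (8 * D / e))%:R).
      by apply: archi_boundP; rewrite divr_ge0 ?mulr_ge0// ltW.
    by rewrite ler_nat (leq_trans _ Mm).
  by move: H; rewrite ltr_pdivrMr//; lra.
exists M => m n Mm Mn.
have m0 : (0 < m)%N by rewrite (leq_trans _ Mm).
have n0 : (0 < n)%N by rewrite (leq_trans _ Mn).
have H1 := absorb_mean m n m0 n0; have H2 := absorb_mean n m n0 m0.
have H3 := DM m Mm; have H4 := DM n Mn.
have cmn : cesaro_mean S n * cesaro_mean S m = cesaro_mean S m * cesaro_mean S n.
  by apply: cesaro_comm; apply: commr_sym; exact: cesaro_comm.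
rewrite cmn in H2.
apply: (le_lt_trans (opnorm_triangle (cesaro_mean S m * cesaro_mean S n) _ _)).
rewrite opnormB; lra.
Qed.

End Orbits.

(** * The equivalences *)

Section Equivalences.
Context {R : realType} {X : completeNormedModType R[i]}.
Local Notation L := (bounded_op X).
Implicit Types (T : L) (a z : R[i]).

Lemma rotationally_ergodic_spectrum T : rotationally_uniformly_ergodic T ->
  (forall z, spectrum T z -> normc z <= 1) /\ peripheral_group_inverses T.
Proof.
move=> eT; split=> z.
  apply: ergodic_spectrum; rewrite -[T]scale1r.
  by apply: eT; apply/unit_circleE; exact: normc1.
move=> z1; apply: rotation_group_inverse.
  by apply/eqP => z0; move: z1; rewrite z0 normc0 => /esym/eqP; rewrite oner_eq0.
by apply: eT; apply/unit_circleE; rewrite normcV z1 invr1.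
Qed.

Lemma peripheral_simple_polesP T :
  (forall z, (spectrum T `&` unit_circle) z -> simple_pole_of_resolvent T z) <->
  peripheral_group_inverses T.
Proof.
split=> [H z z1|H z [sz /unit_circleE z1]].
  have [sz|/resolventP VT] := pselect (spectrum T z).
    by apply: simple_pole_group_inverse; apply: H; split=> //; apply/unit_circleE.
  by exists (resolvent T z); exact: is_inverse_group_inverse.
by have [B AB] := H z z1; exact: group_inverse_simple_pole AB sz.
Qed.

Lemma peripheral_orbit_compact T :
  (forall z, spectrum T z -> normc z <= 1) -> peripheral_group_inverses T ->
  exists2 K : set L, compact K & forall n, K (T ^+ n).
Proof.
move=> T1 HT; have /finite_seqP[s sE] := peripheral_spectrum_finite HT.
apply: (power_orbit_compact (s := s) T1 HT) => z.
  by move=> zs; have [_ /unit_circleE] : (spectrum T `&` unit_circle) z by rewrite sE.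
move=> sz z1; suff : [set` s] z by [].
by rewrite -sE; split=> //; apply/unit_circleE.
Qed.

Lemma orbit_compact_rotationally_ergodic T (K : set L) :
  compact K -> (forall n, K (T ^+ n)) -> rotationally_uniformly_ergodic T.
Proof.
move=> cK TK a /unit_circleE a1.
pose f (p : R[i]^o * L) : L := p.1 *: p.2.
have cf : continuous f.
  by move=> p; apply: cvgZ; [exact: cvg_fst|exact: cvg_snd].
apply: (@orbit_compact_ergodic _ _ _ (f @` (([set z | normc z = 1] : set R[i]^o) `*` K))).
  apply: continuous_compact; first exact: continuous_subspaceT.
  by apply: compact_setX => //; exact: unit_circle_compact.
move=> n; exists (a ^+ n, T ^+ n).
  by split => /=; [rewrite normcX a1 expr1n|exact: TK].
rewrite /f /=; elim: n => [|n IH]; first by rewrite !expr0 scale1r.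
by rewrite !exprS -IH -bop_scaleAl -bop_scaleAr scalerA.
Qed.

(** A compact subset of a Hausdorff space is closed. *)
Lemma precompact_orbitP T : precompact [set T ^+ n | n in [set: nat]] <->
  exists2 K : set L, compact K & forall n, K (T ^+ n).
Proof.
split=> [[K TK [cK _]]|[K cK TK]]; exists K => //.
- by move=> n; apply: TK; exists n.
- by move=> _ [n _ <-]; exact: TK.
- by split=> //; apply: compact_closed => //; exact: norm_hausdorff.
Qed.

End Equivalences.

Theorem theorem4p1 (R : realType) (X : completeNormedModType R[i])
    (T : bounded_op X) :
  let cond_i := rotationally_uniformly_ergodic T in
  let cond_ii := spectral_radius T <= 1 /\
    forall z, (spectrum T `&` unit_circle) z -> simple_pole_of_resolvent T z in
  let cond_iii := precompact [set T ^+ n | n in [set: nat]] in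
  [/\ cond_i <-> cond_ii,
      cond_ii <-> cond_iii &
      cond_i \/ cond_ii \/ cond_iii ->
        power_bounded T /\ finite_set (spectrum T `&` unit_circle)].
Proof.
move=> cond_i cond_ii cond_iii.
have i_ii : cond_i -> cond_ii.
  move=> /rotationally_ergodic_spectrum[T1 HT].
  by split; [exact/spectral_radius_le1P|exact/peripheral_simple_polesP].
have ii_iii : cond_ii -> cond_iii.
  move=> [/spectral_radius_le1P T1 /peripheral_simple_polesP HT].
  by apply/precompact_orbitP; exact: peripheral_orbit_compact.
have iii_i : cond_iii -> cond_i.
  by move=> /precompact_orbitP[K cK TK]; exact: orbit_compact_rotationally_ergodic TK.
split; [split; tauto|split; tauto|move=> H].
have /i_ii[_ /peripheral_simple_polesP HT] : cond_i by tauto.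
split; last exact: peripheral_spectrum_finite.
have /precompact_orbitP[K cK TK] : cond_iii by tauto.
by have [C _ TC] := orbit_bounded cK TK; exists C.
Qed.
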